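(* Let $\varphi\in C^1(\mathbb{R}^2)$ be compactly supported with $\operatorname{supp}(\varphi)\subseteq[N_1,M_1]\times[N_2,M_2]$ and $\widehat{\varphi}(\boldsymbol{0})=0$, with $\nu_2(\varphi)>1/2$ and $\{\varphi(\cdot-\boldsymbol{k}):\boldsymbol{k}\in\mathbb{Z}^2\}$ linearly independent, and let $f\in V(\varphi,\mathbb{Z}^2)$ be an arbitrary target function with $\operatorname{supp}(f)\subseteq[a_1,b_1]\times[a_2,b_2]$. Let $$E=\big([\lceil a_1-M_1\rceil,\lfloor b_1-N_1\rfloor]\times[\lceil a_2-M_2\rceil,\lfloor b_2-N_2\rfloor]\big)\cap\mathbb{Z}^2=\{\boldsymbol{k}_1,\dots,\boldsymbol{k}_{\#E}\},$$ and let $E^+=\emptyset$ if $\#E=1$ and $E^+=\{\boldsymbol{x}-\boldsymbol{y}:\boldsymbol{x}\neq\boldsymbol{y}\in E\}$ if $\#E>1$. Let $\boldsymbol{p}\in\mathrm{DV}_{\widehat{\varphi}}\setminus\mathrm{dv}_{\mathcal{N}_{E^+}}$ and put $$L_{\boldsymbol{p},1}=-\sqrt2\max\{|N_i|,|M_i|:i=1,2\}+\min\{\boldsymbol{p}\boldsymbol{k}:\boldsymbol{k}\in E\},$$ $$L_{\boldsymbol{p},2}=\sqrt2\max\{|N_i|,|M_i|:i=1,2\}+\max\{\boldsymbol{p}\boldsymbol{k}:\boldsymbol{k}\in E\},$$ $$\delta_{\boldsymbol{p}}=\sqrt{\frac{\lambda_{\min}(G_{\varphi,\boldsymbol{p}})}{3\,\#E\,(L_{\boldsymbol{p},2}-L_{\boldsymbol{p},1})}}\Big/\Big(2(\|\varphi_1\|_\infty+\|\varphi_2\|_\infty)\max\{|N_i|,|M_i|:i=1,2\}\Big),\qquad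 K_{\boldsymbol{p}}=\Big\lceil\frac{L_{\boldsymbol{p},2}-L_{\boldsymbol{p},1}}{\delta_{\boldsymbol{p}}}\Big\rceil,$$ where $\lambda_{\min}(G_{\varphi,\boldsymbol{p}})$ is the minimum eigenvalue of the Gram matrix $$G_{\varphi,\boldsymbol{p}}=\Big(\int_{\mathbb{R}}\mathcal{R}_{\boldsymbol{p}}\varphi(x-\boldsymbol{p}\boldsymbol{k}_j)\,\overline{\mathcal{R}_{\boldsymbol{p}}\varphi(x-\boldsymbol{p}\boldsymbol{k}_n)}\,dx\Big)_{j,n=1}^{\#E},$$ $\varphi_1,\varphi_2$ are the partial derivatives of $\varphi(x_1,x_2)$ with respect to $x_1$ and $x_2$, and $\|\varphi_i\|_\infty=\max_{(x_1,x_2)\in[N_1,M_1]\times[N_2,M_2]}|\varphi_i(x_1,x_2)|$. Let $$Y_{\boldsymbol{p}}=\Big\{x_k=L_{\boldsymbol{p},1}+\frac{L_{\boldsymbol{p},2}-L_{\boldsymbol{p},1}}{K_{\boldsymbol{p}}}(k-1):k=1,\dots,K_{\boldsymbol{p}}+1\Big\}.$$ Then there exists $X_{\boldsymbol{p}}=\{x_{i_1},\dots,x_{i_{\#E}}\}\subseteq Y_{\boldsymbol{p}}$ such that the $\#E\times\#E$ matrix $\big(\mathcal{R}_{\boldsymbol{p}}\varphi(x_{i_j}-\boldsymbol{p}\boldsymbol{k}_n)\big)_{j,n=1}^{\#E}$ is invertible, and consequently $f$ can be determined uniquely by its single-angle Radon samples (with respect to $\boldsymbol{p}$) at $X_{\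boldsymbol{p}}$.
   Context: Vectors in $\mathbb{R}^2$ are columns; a direction vector $\boldsymbol{p}=(\cos\theta,\sin\theta)$ is a row vector, so $\boldsymbol{p}\boldsymbol{k}=k_1\cos\theta+k_2\sin\theta$. $\mathcal{R}_{\boldsymbol{p}}f(t)=\int_{-\infty}^{\infty}f(t\cos\theta-s\sin\theta,\,t\sin\theta+s\cos\theta)\,ds$. The Fourier transform is $\widehat{g}(\gamma)=\int_{\mathbb{R}^d}g(\boldsymbol{x})e^{-i\boldsymbol{x}\cdot\gamma}d\boldsymbol{x}$. $H^\varsigma(\mathbb{R}^d)=\{g:\int_{\mathbb{R}^d}|\widehat g(\xi)|^2(1+\|\xi\|_2^2)^{\varsigma}d\xi<\infty\}$ and $\nu_2(g)=\sup\{\varsigma:g\in H^\varsigma(\mathbb{R}^d)\}$. $V(\varphi,\mathbb{Z}^2)=\{\sum_{\boldsymbol{k}\in\mathbb{Z}^2}c_{\boldsymbol{k}}\varphi(\cdot-\boldsymbol{k}):\sum_{\boldsymbol{k}}|c_{\boldsymbol{k}}|^2<\infty\}$. The set $E$ is understood to be nonempty. For $\mathcal{S}\subseteq\mathbb{R}^2$ with $\mathcal{S}\setminus\{\boldsymbol{0}\}\ne\emptyset$: the direction vector set is $\mathrm{dv}_{\mathcal{S}}=\{(\cos\theta,\sin\theta):\ \boldsymbol{0}\neq\boldsymbol{x}=\|\boldsymbol{x}\|_2(\cos\theta,\sin\theta)^T\in\mathcal{S}\}$, and the null set is $\mathcal{N}_{\mathcal{S}}=\{\boldsymbol{0}\ne\boldsymbol{y}\in\mathbb{R}^2:\text{there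 is }\boldsymbol{0}\neq\boldsymbol{x}\in\mathcal{S}\text{ with }\boldsymbol{x}^T\boldsymbol{y}=0\}$. For $\mathcal{S}=\emptyset$ or $\{\boldsymbol{0}\}$, both sets are defined to be $\emptyset$. Let $\mathring{\mathcal{D}}(\boldsymbol{x}_0,\delta)=\{\boldsymbol{x}\in\mathbb{R}^2:\|\boldsymbol{x}-\boldsymbol{x}_0\|_2<\delta\}$. Let $\mathcal{G}_{\widehat{\varphi}}=\{\boldsymbol{x}\in\mathbb{R}^2:\widehat{\varphi}(\boldsymbol{x})\ne0\}$, and for $\boldsymbol{x}\in\mathcal{G}_{\widehat{\varphi}}$ let $\delta^{\widehat{\varphi}}_{\boldsymbol{x},\max}\in(0,\infty]$ be the maximum value such that $\widehat{\varphi}$ has no zero in $\mathring{\mathcal{D}}(\boldsymbol{x},\delta^{\widehat{\varphi}}_{\boldsymbol{x},\max})$. Then $\mathrm{DV}_{\widehat{\varphi}}=\bigcup_{\boldsymbol{x}\in\mathcal{G}_{\widehat{\varphi}}}\mathrm{dv}_{\mathring{\mathcal{D}}(\boldsymbol{x},\delta^{\widehat{\varphi}}_{\boldsymbol{x},\max})}$. Standing convention: a target function $f\in V(\varphi,\mathbb{Z}^2)$ with $\operatorname{supp}(f)\subseteq[a_1,b_1]\times[a_2,b_2]$ is one expressed as $f=\sum_{\boldsymbol{k}\in E}c_{\boldsymbol{k}}\varphi(\cdot-\boldsymbol{k})$ with $c_{\boldsymbol{k}}\in\mathbb{C}$. ''$f$ can be determined uniquely by its single-angle Radon samples at $X$''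 means that $f$ is the only function $h$ of the form $\sum_{\boldsymbol{k}\in E}d_{\boldsymbol{k}}\varphi(\cdot-\boldsymbol{k})$, $d_{\boldsymbol{k}}\in\mathbb{C}$, with $\mathcal{R}_{\boldsymbol{p}}h(x)=\mathcal{R}_{\boldsymbol{p}}f(x)$ for all $x\in X$. *)

(* Defs.v *)
From HB Require Import structures.
From mathcomp Require Import all_boot all_order all_algebra.
From mathcomp Require Import all_classical all_reals all_analysis.
From mathcomp Require Import complex.

Set Implicit Arguments.
Unset Strict Implicit.
Unset Printing Implicit Defensive.

Import Order.TTheory GRing.Theory Num.Theory.
Import numFieldNormedType.Exports.

Local Open Scope classical_set_scope.
Local Open Scope complex_scope.
Local Open Scope ring_scope.

(* R^2 is [R * R] and C is [R[i]].  The norm attached by the library to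
   [R * R] is the sup norm: it has the right topology, but the Euclidean norm
   has to be defined separately. *)
Definition dot (R : realType) (x y : R * R) : R := x.1 * y.1 + x.2 * y.2.

Definition enorm (R : realType) (x : R * R) : R := Num.sqrt (dot x x).

Definition zvec (R : realType) (k : int * int) : R * R := (k.1%:~R, k.2%:~R).
Arguments zvec R k : clear implicits.

Definition dotZ (R : realType) (p : R * R) (k : int * int) : R := dot p (zvec R k).

Definition cmod (R : realType) (z : R[i]) : R :=
  Num.sqrt (complex.Re z ^+ 2 + complex.Im z ^+ 2).

Definition cintegral d (T : measurableType d) (R : realType)
    (mu : {measure set T -> \bar R}) (F : T -> R[i]) : R[i] :=
  (\int[mu]_(x in [set: T]) complex.Re (F x)) +i*
  (\int[mu]_(x in [set: T]) complex.Im (F x)).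

Definition lebesgue2 (R : realType) :
    {measure set (measurableTypeR R * measurableTypeR R) -> \bar R} :=
  (@lebesgue_measure R \x @lebesgue_measure R)%E.
Arguments lebesgue2 R : clear implicits.

Definition radon (R : realType) (p : R * R) (g : R * R -> R[i]) (t : R) : R[i] :=
  cintegral (@lebesgue_measure R)
    (fun s => g (t * p.1 - s * p.2, t * p.2 + s * p.1)).

Definition fourier (R : realType) (g : R * R -> R[i]) (xi : R * R) : R[i] :=
  cintegral (lebesgue2 R)
    (fun x => g x * (cos (dot x xi) -i* sin (dot x xi))).

Definition sobolev (R : realType) (s : R) (g : R * R -> R[i]) : Prop :=
  (\int[lebesgue2 R]_(xi in [set: R * R])
     (cmod (fourier g xi) ^+ 2 * (1 + enorm xi ^+ 2) `^ s)%:E < +oo)%E.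

Definition nu2 (R : realType) (g : R * R -> R[i]) : \bar R :=
  ereal_sup [set s%:E | s in [set s : R | sobolev s g]].

Definition supp (R : realType) (g : R * R -> R[i]) : set (R * R) :=
  closure [set x | g x != 0].

Definition box (R : realType) (a1 b1 a2 b2 : R) : set (R * R) :=
  [set x | a1 <= x.1 <= b1 /\ a2 <= x.2 <= b2].

(* Directional derivative of a complex-valued function of two real variables,
   computed on real and imaginary parts. *)
Definition cderive (R : realType) (g : R * R -> R[i]) (v : R * R) (x : R * R) : R[i] :=
  ('D_v (fun y => complex.Re (g y)) x) +i* ('D_v (fun y => complex.Im (g y)) x).

Definition e1 (R : realType) : R * R := (1, 0).
Definition e2 (R : realType) : R * R := (0, 1).
Arguments e1 R : clear implicits.
Arguments e2 R : clear implicits.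

Definition C1_real (R : realType) (u : R * R -> R) : Prop :=
  forall v : R * R, v = e1 R \/ v = e2 R ->
    (forall x, derivable u x v) /\ continuous (fun x => 'D_v u x).

Definition C1 (R : realType) (g : R * R -> R[i]) : Prop :=
  C1_real (fun x => complex.Re (g x)) /\ C1_real (fun x => complex.Im (g x)).

Definition sup_norm_on (R : realType) (B : set (R * R)) (g : R * R -> R[i]) : R :=
  sup [set cmod (g x) | x in B].

Definition zshift (R : realType) (phi : R * R -> R[i]) (k : int * int)
  : R * R -> R[i] := fun x => phi (x - zvec R k).

Definition shifts_lin_indep (R : realType) (phi : R * R -> R[i]) : Prop :=
  forall (s : seq (int * int)) (c : int * int -> R[i]), uniq s ->
    (forall x, \sum_(k <- s) c k * zshift phi k x = 0) ->
    forall k, k \in s -> c k = 0.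

(* For compactly supported [phi], at every [x] only finitely many terms of the
   sum are nonzero, which is what [\sum_(_ \in _)] requires. *)
Definition shift_space (R : realType) (phi : R * R -> R[i]) : set (R * R -> R[i]) :=
  [set f | exists c : int * int -> R[i],
     (\esum_(k in [set: int * int]) (cmod (c k) ^+ 2)%:E < +oo)%E /\
     forall x, f x = \sum_(k \in [set: int * int]) c k * zshift phi k x].

(* The empty-set conventions for [S] empty or [S = {0}] hold automatically for
   the next two definitions. *)
Definition dv (R : realType) (S : set (R * R)) : set (R * R) :=
  [set p | exists (theta : R) (x : R * R),
     [/\ p = (cos theta, sin theta), x != 0, S x &
         x = (enorm x * cos theta, enorm x * sin theta)]].

Definition orth_set (R : realType) (S : set (R * R)) : set (R * R) :=
  [set y | y != 0 /\ exists x, [/\ x != 0, S x & dot x y = 0]].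

Definition odisc (R : realType) (x0 : R * R) (delta : \bar R) : set (R * R) :=
  [set x | ((enorm (x - x0))%:E < delta)%E].

(* The supremum is attained, because an open disc is the union of the smaller
   concentric discs. *)
Definition delta_max (R : realType) (g : R * R -> R[i]) (x : R * R) : \bar R :=
  ereal_sup [set delta : \bar R |
    (0 < delta)%E /\ forall y, odisc x delta y -> g y != 0].

Definition DV (R : realType) (g : R * R -> R[i]) : set (R * R) :=
  \bigcup_(x in [set x | g x != 0]) dv (odisc x (delta_max g x)).

Definition index_set (R : realType) (N1 M1 N2 M2 a1 b1 a2 b2 : R) : set (int * int) :=
  [set k | Num.ceil (a1 - M1) <= k.1 <= Num.floor (b1 - N1) /\
           Num.ceil (a2 - M2) <= k.2 <= Num.floor (b2 - N2)].

(* Empty when [E] is a singleton. *)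
Definition Eplus (R : realType) (E : set (int * int)) : set (R * R) :=
  [set z | exists x y, [/\ E x, E y, x != y & z = zvec R x - zvec R y]].
Arguments Eplus R E : clear implicits.

Definition box_radius (R : realType) (N1 M1 N2 M2 : R) : R :=
  Num.max (Num.max `|N1| `|M1|) (Num.max `|N2| `|M2|).

(* [inf] and [sup] over the finite nonempty set [E] are a minimum and a
   maximum. *)
Definition L1 (R : realType) (N1 M1 N2 M2 : R) (E : set (int * int)) (p : R * R) : R :=
  - Num.sqrt 2 * box_radius N1 M1 N2 M2 + inf [set dotZ p k | k in E].

Definition L2 (R : realType) (N1 M1 N2 M2 : R) (E : set (int * int)) (p : R * R) : R :=
  Num.sqrt 2 * box_radius N1 M1 N2 M2 + sup [set dotZ p k | k in E].

Definition gram (R : realType) (phi : R * R -> R[i]) (p : R * R) (m : nat)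
    (k : 'I_m -> int * int) : 'M[R[i]]_m :=
  \matrix_(j, n) cintegral (@lebesgue_measure R)
    (fun x => radon p phi (x - dotZ p (k j)) * conjc (radon p phi (x - dotZ p (k n)))).

(* For Hermitian [A] of positive size, the eigenvalues form a finite nonempty
   set of reals, so this infimum is the minimum eigenvalue. *)
Definition lambda_min (R : realType) (m : nat) (A : 'M[R[i]]_m) : R :=
  inf [set a : R | eigenvalue A a%:C].

Definition delta_p (R : realType) (phi : R * R -> R[i]) (N1 M1 N2 M2 : R)
    (E : set (int * int)) (p : R * R) (m : nat) (k : 'I_m -> int * int) : R :=
  let B := box N1 M1 N2 M2 in
  Num.sqrt (lambda_min (gram phi p k)
            / (3 * m%:R * (L2 N1 M1 N2 M2 E p - L1 N1 M1 N2 M2 E p)))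
  / (2 * (sup_norm_on B (cderive phi (e1 R)) + sup_norm_on B (cderive phi (e2 R)))
     * box_radius N1 M1 N2 M2).

Definition K_p (R : realType) (phi : R * R -> R[i]) (N1 M1 N2 M2 : R)
    (E : set (int * int)) (p : R * R) (m : nat) (k : 'I_m -> int * int) : int :=
  Num.ceil ((L2 N1 M1 N2 M2 E p - L1 N1 M1 N2 M2 E p)
            / delta_p phi N1 M1 N2 M2 E p k).

Definition Y_p (R : realType) (phi : R * R -> R[i]) (N1 M1 N2 M2 : R)
    (E : set (int * int)) (p : R * R) (m : nat) (k : 'I_m -> int * int) : set R :=
  let K := K_p phi N1 M1 N2 M2 E p k in
  [set L1 N1 M1 N2 M2 E p
       + (L2 N1 M1 N2 M2 E p - L1 N1 M1 N2 M2 E p) / K%:~R * (l - 1)%:~R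
   | l in [set l : int | 1 <= l <= K + 1]].

Definition combo (R : realType) (phi : R * R -> R[i]) (m : nat)
    (k : 'I_m -> int * int) (c : 'I_m -> R[i]) : R * R -> R[i] :=
  fun x => \sum_(j < m) c j * zshift phi (k j) x.

Definition determined_at (R : realType) (phi : R * R -> R[i]) (m : nat)
    (k : 'I_m -> int * int) (p : R * R) (f : R * R -> R[i]) (X : set R) : Prop :=
  forall h : R * R -> R[i], (exists d, h = combo phi k d) ->
    (forall x, X x -> radon p h x = radon p f x) -> h = f.

(* Main.v *)
Require Import Defs.
From HB Require Import structures.
From mathcomp Require Import all_boot all_order all_algebra.
From mathcomp Require Import all_classical all_reals all_analysis.
From mathcomp Require Import measurable_realfun sesquilinear spectral.
From mathcomp Require Import complex ring lra.

(* The Fourier slice identity equates the one-dimensional Fourier transform of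
   the Radon transform rho = R_p phi with the restriction of the Fourier
   transform of phi to the line spanned by p; as p lies in DV, rho is nonzero.
   As p avoids dv of the null set of E+, the shifts p k, k in E, are distinct, so
   the corresponding translates of the compactly supported rho are linearly
   independent and their Gram matrix is positive definite.  If a combination g of
   the translates with coefficient vector v vanishes on the grid, every point of
   [L1, L2] is within delta / 2 of a zero of g, and the Lipschitz bound on g gives
   \int |g|^2 <= (lambda_min / 3) |v|^2, whereas \int |g|^2 >= lambda_min |v|^2;
   so v = 0.  The full sampling matrix thus has trivial kernel, and some #E of its
   rows form an invertible matrix. *)

Set Implicit Arguments.
Unset Strict Implicit.
Unset Printing Implicit Defensive.

Import Order.TTheory GRing.Theory Num.Theory.
Import numFieldNormedType.Exports.

Local Open Scope classical_set_scope.
Local Open Scope complex_scope.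
Local Open Scope ring_scope.

(** * Lebesgue measure on the plane *)

(** The constants in [delta_p] come from geometry. Write $B$ for the [box_radius] and $S$ for the
    sum of the two sup norms. The support lies in the disc of radius $\sqrt2B$, so only a parameter
    interval of length $2\sqrt2B$ counts on each line, and the real and imaginary parts of $\rho$
    are Lipschitz with constant $\Lambda=2\sqrt2BS$. They are treated separately because [cintegral]
    is defined through them; at distance $\delta/2$ the squared modulus of an increment is at most
    $2(\Lambda\delta/2)^2$. Cauchy-Schwarz over the translates contributes a factor $\#E$,
    integration the length $L_2-L_1$. [delta_p] makes the product equal to $\lambda_{\min}/3$; being
    below $\lambda_{\min}$ is what forces $v=0$. Infima, suprema and quotients have default values,
    so $S$, $B$ and $\lambda_{\min}$ must be shown positive before [delta_p] means anything; for $S$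
    and $B$ this again comes from $\rho\neq0$. The slice identity rests on rotation invariance of
    the product measure, which is derived from translation invariance through shears. *)

Section plane_measure.
Context {R : realType}.
Implicit Types (F : R * R -> R) (u : R -> R).

Let RR := (measurableTypeR R * measurableTypeR R)%type.
Local Notation mu := (@lebesgue_measure R).

(** An open set is the union of the squares with rational centre and rational radius that it
    contains. There are countably many of them, and each is a product of two intervals. *)
Lemma open_measurable_plane (U : set (R * R)) : open U -> measurable (U : set RR).
Proof.
move=> oU.
pose D (q : rat * rat * rat) : set RR :=
  ball (ratr q.1.1 : R) (ratr q.2) `*` ball (ratr q.1.2 : R) (ratr q.2).
have -> : (U : set RR) = \bigcup_q (if `[< D q `<=` U >] then D q else set0).
  apply/seteqP; split => [x Ux|x [q _]]; last by case: asboolP => // + Dx; exact.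
  have /nbhs_ballP[e /= e0 eU] : nbhs x U by apply: open_nbhs_nbhs.
  (* The radius [e'] is below [e / 2], so a square of radius [e'] that contains [x] stays inside the
     ball of radius [e] about [x]. *)
  have [e' /[!in_itv]/= /andP[e'0 e'e]] := rat_in_itvoo (divr_gt0 e0 (ltr0n R 2)).
  have H (t : R) : exists q : rat, ball (ratr q : R) (ratr e') t.
    have [|q /[!in_itv]/= /andP[q1 q2]] := @rat_in_itvoo R (t - ratr e') (t + ratr e').
      by lra.
    by exists q; rewrite /ball/= ltr_norml; apply/andP; split; lra.
  have [q1 hq1] := H x.1; have [q2 hq2] := H x.2.
  exists ((q1, q2), e') => //; case: asboolP => // -[]; rewrite /D /=.
  move=> y [y1 y2]; apply: eU; split.
    by apply: (@le_ball _ _ _ (ratr e' + ratr e')); [lra|exact: ball_triangle (ball_sym hq1) y1].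
  by apply: (@le_ball _ _ _ (ratr e' + ratr e')); [lra|exact: ball_triangle (ball_sym hq2) y2].
apply: countable_bigcupT_measurable => // q; case: asboolP => // _.
by apply: measurableX; apply: open_measurable; exact: ball_open.
Qed.

Lemma measurable_continuous_plane F : continuous F ->
  measurable_fun setT (F : RR -> measurableTypeR R).
Proof.
move=> cF; apply: (measurability _ (RGenOpens.measurableE R)).
move=> _ [_ [a [b ->] <-]]; rewrite setTI; apply: open_measurable_plane.
by move/continuousP: cF; apply; exact: interval_open.
Qed.

Definition translation (a : R) : measurableTypeR R -> measurableTypeR R :=
  fun x => x + a.

Lemma measurable_translation (a : R) : measurable_fun setT (translation a).
Proof. exact: measurable_funD. Qed.

HB.instance Definition _ a :=
  isMeasurableFun.Build _ _ _ _ (translation a) (measurable_translation a).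

(** By uniqueness of Lebesgue measure it suffices to compare both sides on half-open intervals,
    whose preimages are intervals of the same length. *)
Lemma lebesgue_measure_translation (a : R) (A : set (measurableTypeR R)) :
  measurable A -> mu A = pushforward mu (translation a) A.
Proof.
apply: lebesgue_measure_unique => _ [[x y] _ <-].
rewrite /pushforward.
rewrite [X in _ = mu X](_ : _ = `]x - a, y - a]%classic); last first.
  by apply/seteqP; split => z /=; rewrite !in_itv/= /translation => /andP[? ?];
    apply/andP; split; lra.
rewrite !lebesgue_measure_itv/= !lte_fin ltrD2r.
by case: ifP => // _; congr (_%:E); lra.
Qed.

Lemma ge0_integral_translation (a : R) (f : measurableTypeR R -> \bar R) :
  measurable_fun setT f -> (forall x, 0 <= f x)%E ->
  (\int[mu]_x f (x + a)%R = \int[mu]_x f x)%E.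
Proof.
move=> mf f0.
rewrite [RHS](eq_measure_integral (pushforward mu (translation a))); last first.
  by move=> A mA _; exact: lebesgue_measure_translation.
by rewrite ge0_integral_pushforward//; exact: measurable_translation.
Qed.

(** In Tonelli's theorem, integrate first in the coordinate that moves: for a fixed second
    coordinate the shear is a translation. *)
Lemma ge0_integral_shear1 (a : R) (f : RR -> \bar R) :
  measurable_fun setT f -> (forall x, 0 <= f x)%E ->
  (\int[lebesgue2 R]_x f (x.1 + a * x.2, x.2)%R = \int[lebesgue2 R]_x f x)%E.
Proof.
move=> mf f0; rewrite /lebesgue2 !fubini_tonelli2//; last first.
  apply: measurableT_comp => //; apply: measurable_fun_pair => //.
  by apply: measurable_funD => //; apply: measurable_funM.
apply: eq_integral => y _; rewrite /fubini_G /=.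
apply: (@ge0_integral_translation (a * y) (fun x => f (x, y))) => //.
exact: measurableT_comp.
Qed.

Lemma ge0_integral_shear2 (a : R) (f : RR -> \bar R) :
  measurable_fun setT f -> (forall x, 0 <= f x)%E ->
  (\int[lebesgue2 R]_x f (x.1, x.2 + a * x.1)%R = \int[lebesgue2 R]_x f x)%E.
Proof.
move=> mf f0; rewrite /lebesgue2 !fubini_tonelli1//; last first.
  apply: measurableT_comp => //; apply: measurable_fun_pair => //.
  by apply: measurable_funD => //; apply: measurable_funM.
apply: eq_integral => y _; rewrite /fubini_F /=.
apply: (@ge0_integral_translation (a * y) (fun x => f (y, x))) => //.
exact: measurableT_comp.
Qed.

(* [rotate p (t, s)] is the point at abscissa [s] on the line over which
   [radon p _ t] integrates. *)
Definition rotate (p x : R * R) : R * R :=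
  (x.1 * p.1 - x.2 * p.2, x.1 * p.2 + x.2 * p.1).

Lemma measurable_rotate p : measurable_fun setT (rotate p : RR -> RR).
Proof.
apply: measurable_fun_pair.
  by apply: measurable_funB; apply: measurable_funM.
by apply: measurable_funD; apply: measurable_funM.
Qed.

(* A rotation of angle other than pi is a product of three shears; the half
   turn is the square of a quarter turn. *)
Lemma ge0_integral_rotate p (f : RR -> \bar R) : dot p p = 1 ->
  measurable_fun setT f -> (forall x, 0 <= f x)%E ->
  (\int[lebesgue2 R]_x f (rotate p x) = \int[lebesgue2 R]_x f x)%E.
Proof.
wlog pN1 : p f / p.1 != -1 => [hwlog|] p1 mf f0.
  have [pE|/eqP] := eqVneq p.1 (-1); last by move/eqP => ?; apply: hwlog.
  have p2 : p.2 = 0.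
    have /eqP : p.2 ^+ 2 = 0 by move: p1; rewrite /dot pE; nra.
    by rewrite sqrf_eq0 => /eqP.
  have q1 : dot (0, 1) (0, 1) = 1 :> R by rewrite /dot/= mulr0 mulr1 add0r.
  have qN1 : (0 : R) != -1 by rewrite eq_sym oppr_eq0 oner_eq0.
  rewrite -[RHS](hwlog (0, 1))//.
  rewrite -[RHS](hwlog (0, 1) (fun x => f (rotate (0, 1) x)))//; last first.
    by apply: measurableT_comp => //; exact: measurable_rotate.
  apply: eq_integral => x _; congr f; rewrite /rotate/= pE p2.
  by congr pair; lra.
(* For [p] of angle $\theta$ this is $-\tan(\theta/2)$. The rotation is the horizontal shear by [a],
   the vertical one by [p.2], and the horizontal one by [a] again; the matrix identity reduces to
   [a * p.2 = p.1 - 1] and [a * (1 + p.1) = - p.2]. *)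
pose a := - p.2 / (1 + p.1).
have p10 : 1 + p.1 != 0 by rewrite addrC addr_eq0.
have mS1 : measurable_fun setT (fun x : RR => (x.1 + a * x.2, x.2) : RR).
  apply: measurable_fun_pair => //.
  by apply: measurable_funD => //; apply: measurable_funM.
have mS2 : measurable_fun setT (fun x : RR => (x.1, x.2 + p.2 * x.1) : RR).
  apply: measurable_fun_pair => //.
  by apply: measurable_funD => //; apply: measurable_funM.
rewrite -[RHS](ge0_integral_shear1 a)//.
rewrite -[RHS](@ge0_integral_shear2 p.2 (fun x => f (x.1 + a * x.2, x.2)))//; last first.
  exact: measurableT_comp.
rewrite -[RHS](@ge0_integral_shear1 a (fun x =>
   f (x.1 + a * (x.2 + p.2 * x.1), x.2 + p.2 * x.1)))//; last first.
  have mf1 := measurableT_comp mf mS1; exact: (measurableT_comp mf1 mS2).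
apply: eq_integral => x _; congr f; rewrite /rotate/=.
have ap : a * p.2 = p.1 - 1.
  have pp : - p.2 * p.2 = (p.1 - 1) * (1 + p.1) by move: p1; rewrite /dot; nra.
  by rewrite /a mulrAC pp mulfK.
have aa : p.2 = - (a * p.1 + a).
  have : a * (1 + p.1) = - p.2 by rewrite /a divfK.
  by rewrite mulrDr mulr1; lra.
congr pair.
  transitivity (x.1 * (1 + a * p.2) + x.2 * (a + a + (a * p.2) * a)); last by ring.
  by rewrite ap aa; ring.
by transitivity (x.1 * p.2 + x.2 * (1 + a * p.2)); [rewrite ap; ring|ring].
Qed.

End plane_measure.

Lemma continuous_pair (T U V : topologicalType) (f : T -> U) (g : T -> V) :
  continuous f -> continuous g -> continuous (fun x => (f x, g x)).
Proof.
move=> cf cg x; apply: (@cvg_pair _ _ _ _ (nbhs (f x)) (nbhs (g x))); [exact: cf|exact: cg].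
Qed.

(** * Integrals of signed functions: invariance, bounds and Fubini *)

Section fubini_plane.
Context {R : realType}.
Implicit Types (F : R * R -> R) (u : R -> R) (B C : R).

Let RR := (measurableTypeR R * measurableTypeR R)%type.
Local Notation mu := (@lebesgue_measure R).

(** The positive and negative parts are transported separately, so the extended integrals agree
    before [fine] is applied, whether or not they are finite. *)
Lemma Rintegral_rotate p F : dot p p = 1 ->
  measurable_fun setT (F : RR -> measurableTypeR R) ->
  \int[lebesgue2 R]_x F (rotate p x) = \int[lebesgue2 R]_x F x.
Proof.
move=> p1 mF; rewrite /Rintegral; congr fine.
have mE : measurable_fun setT (EFin \o F : RR -> \bar R) by exact/measurable_EFinP.
rewrite integralE [RHS]integralE; congr (_ - _)%E.
  rewrite -[RHS](ge0_integral_rotate p1 (measurable_funepos mE))//.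
  by apply: eq_integral => x _; rewrite unlock.
rewrite -[RHS](ge0_integral_rotate p1 (measurable_funeneg mE))//.
by apply: eq_integral => x _; rewrite unlock.
Qed.

Lemma Rintegral_translation (a : R) u :
  measurable_fun setT (u : measurableTypeR R -> measurableTypeR R) ->
  \int[mu]_x u (x + a) = \int[mu]_x u x.
Proof.
move=> mu'; rewrite /Rintegral; congr fine.
have mE : measurable_fun setT (EFin \o u : measurableTypeR R -> \bar R).
  exact/measurable_EFinP.
rewrite integralE [RHS]integralE; congr (_ - _)%E.
  rewrite -[RHS](ge0_integral_translation a (measurable_funepos mE))//.
  by apply: eq_integral => x _; rewrite unlock.
rewrite -[RHS](ge0_integral_translation a (measurable_funeneg mE))//.
by apply: eq_integral => x _; rewrite unlock.
Qed.

Lemma integrable_bounded_support d (T : measurableType d)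
    (nu : {measure set T -> \bar R}) (A : set T) (h : T -> R) C :
  measurable A -> (nu A < +oo)%E -> measurable_fun setT h ->
  (forall x, `|h x| <= C) -> (forall x, h x != 0 -> A x) ->
  nu.-integrable setT (EFin \o h).
Proof.
move=> mA Afin mh hC hA.
have : nu.-integrable A (EFin \o h).
  apply: (@measurable_bounded_integrable _ _ _ nu h A mA Afin).
    exact: measurable_funTS.
  by exists C; split; [exact: num_real|move=> x Cx y _; exact: le_trans (hC y) (ltW Cx)].
rewrite (integrable_mkcond _ mA); congr integrable; apply/funext => x /=.
rewrite /patch; case: ifPn => // xA; congr EFin; apply/esym/eqP/negPn/negP => hx.
by move/negP: xA; apply; rewrite inE; exact: hA.
Qed.

Lemma integrable_line u a b C : continuous u -> (forall x, `|u x| <= C) ->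
  (forall x, u x != 0 -> a <= x <= b) -> mu.-integrable setT (EFin \o u).
Proof.
move=> cu uC uB; pose A : set (measurableTypeR R) := `[a, b]%classic.
apply: (@integrable_bounded_support _ _ mu A u C) => //.
- exact: measurable_itv.
- by rewrite /A /= lebesgue_measure_itv/=; case: ifP => // _; rewrite ltry.
- exact: continuous_measurable_fun.
Qed.

Lemma le_Rintegral_support u a b C : a <= b -> continuous u ->
  (forall x, `|u x| <= C) -> (forall x, u x != 0 -> a <= x <= b) ->
  `|\int[mu]_x u x| <= (b - a) * C.
Proof.
move=> ab cu uC uab.
have iu := integrable_line cu uC uab.
have mI : measurable (`[a, b]%classic : set (measurableTypeR R)) by exact: measurable_itv.
have -> : \int[mu]_x u x = \int[mu]_(x in `[a, b]%classic) u x.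
  rewrite [RHS]Rintegral_mkcond; apply: eq_Rintegral => x _.
  rewrite /patch; case: ifPn => // xA; apply/eqP/negPn/negP => /uab ux.
  by move/negP: xA; apply; rewrite inE/= in_itv/=.
have iuI : mu.-integrable `[a, b]%classic (EFin \o u).
  by apply: integrableS iu.
apply: le_trans (le_normr_Rintegral mI iuI) _.
have ci : mu.-integrable `[a, b]%classic (EFin \o cst C).
  apply: measurable_bounded_integrable => //; last exact: bounded_cst.
  by rewrite /= lebesgue_measure_itv/=; case: ifP => // _; rewrite ltry.
apply: le_trans (@le_Rintegral _ _ _ mu _ (fun x => `|u x|) (cst C) mI _ ci _) _ => //.
  by have := integrable_abse iuI.
rewrite Rintegral_cst//= lebesgue_measure_itv/= lte_fin.
by case: ltrP => ba; rewrite mulrC//= ?subr_cp0; have -> : b - a = 0 by lra.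
Qed.

Lemma integrable_plane F B C : continuous F -> (forall x, `|F x| <= C) ->
  (forall x, F x != 0 -> `|x.1| <= B /\ `|x.2| <= B) ->
  (lebesgue2 R).-integrable setT (EFin \o F).
Proof.
move=> cF FC FB.
pose I : set (measurableTypeR R) := `[- B, B]%classic.
have mI : measurable I by exact: measurable_itv.
apply: (@integrable_bounded_support _ _ (lebesgue2 R) (I `*` I) F C) => //.
- exact: measurableX.
- rewrite [X in (X < _)%E](_ : _ = (mu I * mu I)%E); last by rewrite -product_measure1E.
  by rewrite /I /= lebesgue_measure_itv/=; case: ifP => _; rewrite ?mule0 ?ltry.
- exact: measurable_continuous_plane.
- by move=> x /FB; rewrite /I /= !in_itv/= !ler_norml.
Qed.

Lemma Rintegral_fubini F B C : continuous F -> (forall x, `|F x| <= C) ->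
  (forall x, F x != 0 -> `|x.1| <= B /\ `|x.2| <= B) ->
  \int[lebesgue2 R]_x F x = \int[mu]_t \int[mu]_s F (t, s).
Proof.
move=> cF FC FB; rewrite {1}/Rintegral -(integral12_prod_meas1 (integrable_plane cF FC FB)).
rewrite [RHS]/Rintegral; congr fine; apply: eq_integral => t _.
rewrite /fubini_F /= /Rintegral fineK//.
apply: integrable_fin_num => //; apply: (@integrable_line (fun s => F (t, s)) (- B) B C) => //.
  move=> s; apply: (@continuous_comp _ _ _ (fun s => (t, s)) F); last exact: cF.
  by apply: continuous_pair => [?|?]; [exact: cvg_cst|exact: cvg_id].
by move=> s /FB[_ /=]; rewrite ler_norml.
Qed.

End fubini_plane.

(** * The Radon transform of a Lipschitz function *)

Lemma lipschitz_continuous (R : realType) (V : normedModType R) (u : V -> R) (S : R) :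
  (forall x y, `|u x - u y| <= S * `|x - y|) -> continuous u.
Proof.
move=> uL x; apply/cvgrPdist_lt => e e0.
have S0 : 0 < `|S| + 1 by rewrite ltr_wpDl.
near=> y; apply: le_lt_trans (uL x y) _.
apply: (@le_lt_trans _ _ ((`|S| + 1) * `|x - y|)).
  by rewrite ler_wpM2r// (le_trans (ler_norm _))// lerDl.
rewrite mulrC -ltr_pdivlMr//.
by near: y; apply: cvgr_dist_lt; rewrite ?divr_gt0.
Unshelve. all: by end_near. Qed.

(** Since [cintegral] acts on real and imaginary parts, every estimate on [radon] is first made for
    this real version. *)
Definition real_radon (R : realType) (p : R * R) (u : R * R -> R) (t : R) : R :=
  \int[@lebesgue_measure R]_s u (rotate p (t, s)).

Lemma radonE (R : realType) (p : R * R) (g : R * R -> R[i]) t :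
  radon p g t =
  real_radon p (fun x => complex.Re (g x)) t +i*
  real_radon p (fun x => complex.Im (g x)) t.
Proof. by []. Qed.

Section real_radon_theory.
Context {R : realType} {p : R * R} {u : R * R -> R} {S B : R}.
Hypothesis p1 : dot p p = 1.
Hypothesis uL : forall x y, `|u x - u y| <= S * `|x - y|.
Hypothesis uB : forall x, u x != 0 -> `|x.1| <= B /\ `|x.2| <= B.
Hypothesis B0 : 0 <= B.
Hypothesis S0 : 0 <= S.

Local Notation mu := (@lebesgue_measure R).
Local Notation r := (real_radon p u).

Let c : R := Num.sqrt 2 * B.

Let c0 : 0 <= c. Proof. by rewrite mulr_ge0. Qed.

Lemma dir_le1 : `|p.1| <= 1 /\ `|p.2| <= 1.
Proof. by move: p1; rewrite /dot !ler_norml => ?; split; apply/andP; split; nra. Qed.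

Lemma continuous_rotate : continuous (rotate p).
Proof.
apply: continuous_pair => x.
  by apply: cvgB; apply: cvgMr_tmp; [exact: cvg_fst|exact: cvg_snd].
by apply: cvgD; apply: cvgMr_tmp; [exact: cvg_fst|exact: cvg_snd].
Qed.

(** Rotations preserve the Euclidean norm, and [c] is the half diagonal of the square $[-B,B]^2$. *)
Lemma rotate_box x : `|(rotate p x).1| <= B -> `|(rotate p x).2| <= B ->
  `|x.1| <= c /\ `|x.2| <= c.
Proof.
move=> h1 h2.
have E : (rotate p x).1 ^+ 2 + (rotate p x).2 ^+ 2 = x.1 ^+ 2 + x.2 ^+ 2.
  transitivity ((x.1 ^+ 2 + x.2 ^+ 2) * dot p p); last by rewrite p1 mulr1.
  by rewrite /rotate /dot/=; ring.
have sq (y : R) : `|y| <= B -> y ^+ 2 <= B ^+ 2.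
  by move=> h; rewrite -[y ^+ 2]real_normK ?num_real// ler_pXn2r// nnegrE.
have x2 : x.1 ^+ 2 + x.2 ^+ 2 <= c ^+ 2.
  by rewrite -E /c exprMn sqr_sqrtr//; have := sq _ h1; have := sq _ h2; lra.
by split; rewrite -(@ler_pXn2r _ 2)// ?nnegrE// real_normK ?num_real//;
  apply: le_trans x2; rewrite ?lerDl ?lerDr sqr_ge0.
Qed.

Lemma rotate_support x : u (rotate p x) != 0 -> `|x.1| <= c /\ `|x.2| <= c.
Proof. by move=> /uB[]; exact: rotate_box. Qed.

Lemma lip_continuous : continuous u. Proof. exact: lipschitz_continuous uL. Qed.

(** The point $(B+1,0)$ is outside the support, and its sup-norm distance to any point of the square
    is at most $2B+1$. *)
Lemma lip_bound x : `|u x| <= S * (2 * B + 1).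
Proof.
have [->|ux] := eqVneq (u x) 0; first by rewrite normr0 mulr_ge0// addr_ge0// mulr_ge0.
have [x1 x2] := uB ux.
have uy0 : u (B + 1, 0) = 0.
  by apply/eqP/negPn/negP => /uB[/= + _]; rewrite ger0_norm ?addr_ge0// gerDl ler10.
have := uL x (B + 1, 0); rewrite uy0 subr0 => /le_trans; apply.
rewrite ler_wpM2l// prod_normE/= ge_max subr0; apply/andP; split; last by move: B0 => Bge0; lra.
by move: x1 B0; rewrite !ler_norml => /andP[? ?] ?; apply/andP; split; lra.
Qed.

Lemma slice_continuous t : continuous (fun s => u (rotate p (t, s))).
Proof.
move=> s; apply: (@continuous_comp _ _ _ (fun s => rotate p (t, s)) u); last exact: lip_continuous.
apply: (@continuous_comp _ _ _ (fun s => (t, s)) (rotate p)); last exact: continuous_rotate.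
by apply: continuous_pair => [?|?]; [exact: cvg_cst|exact: cvg_id].
Qed.

Lemma slice_support t s : u (rotate p (t, s)) != 0 -> - c <= s <= c.
Proof. by move=> /rotate_support[_]; rewrite ler_norml. Qed.

Lemma slice_integrable t : mu.-integrable setT (EFin \o (fun s => u (rotate p (t, s)))).
Proof.
have H := @integrable_line _ _ (- c) c (S * (2 * B + 1)) (@slice_continuous t).
by apply: H => s; [exact: lip_bound|exact: slice_support].
Qed.

Lemma real_radon_support t : r t != 0 -> `|t| <= c.
Proof.
apply: contraNT => tc; rewrite /real_radon (_ : (fun _ => _) = cst 0).
  by rewrite Rintegral_cst// mul0r.
apply/funext => s; apply/eqP/negPn/negP => /rotate_support[/=].
by rewrite (negbTE tc).
Qed.

(* The line meets the square [-B, B]^2 only at abscissas at most sqrt 2 B. *)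
Lemma real_radon_lipschitz t t' : `|r t - r t'| <= 2 * c * S * `|t - t'|.
Proof.
rewrite /real_radon -RintegralB//; try exact: slice_integrable.
have -> : 2 * c * S * `|t - t'| = (c - - c) * (S * `|t - t'|) by ring.
apply: le_Rintegral_support.
- by rewrite ge0_cp.
- by move=> s; apply: cvgB; exact: slice_continuous.
- move=> s; apply: le_trans (uL _ _) _; rewrite ler_wpM2l//.
  rewrite prod_normE/= ge_max.
  (* At equal [s] the two points differ by $(t-t')p$, whose sup norm is at most $|t-t'|$. *)
  have [p1' p2'] := dir_le1.
  have -> : t * p.1 - s * p.2 - (t' * p.1 - s * p.2) = (t - t') * p.1 by ring.
  have -> : t * p.2 + s * p.1 - (t' * p.2 + s * p.1) = (t - t') * p.2 by ring.
  by rewrite !normrM !ler_piMr.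
- move=> s; have [e1 e2|//] := eqVneq (u (rotate p (t, s))) 0.
    by apply: (@slice_support t'); apply: contraNneq e2 => ->; rewrite e1 subr0.
  by move=> *; exact: (@slice_support t).
Qed.

Lemma real_radon_continuous : continuous r.
Proof. exact: lipschitz_continuous real_radon_lipschitz. Qed.

Lemma real_radon_bound t : `|r t| <= 2 * c * (S * (2 * B + 1)).
Proof.
have -> : 2 * c * (S * (2 * B + 1)) = (c - - c) * (S * (2 * B + 1)) by ring.
apply: le_Rintegral_support; [by rewrite ge0_cp|exact: slice_continuous| |exact: slice_support].
by move=> s; exact: lip_bound.
Qed.

(** In the rotated coordinates [dot x p] is just [t], so [w] leaves the inner integral over [s].
    With a cosine or a sine for [w] this is the Fourier slice identity, one real component at a
    time. *)
Lemma integral_plane_wave (w : R -> R) : continuous w -> (forall x, `|w x| <= 1) ->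
  \int[lebesgue2 R]_x (u x * w (dot x p)) = \int[mu]_t (w t * r t).
Proof.
move=> cw w1.
have cd : continuous (fun x : R * R => dot x p).
  by move=> x; apply: cvgD; apply: cvgMr_tmp; [exact: cvg_fst|exact: cvg_snd].
have cF : continuous (fun x => u x * w (dot x p)).
  move=> x; apply: cvgM; first exact: lip_continuous.
  by apply: (@continuous_comp _ _ _ (fun x => dot x p) w); [exact: cd|exact: cw].
rewrite -(Rintegral_rotate p1 (F := fun x => u x * w (dot x p))); last first.
  exact: measurable_continuous_plane.
rewrite (@Rintegral_fubini _ _ c (S * (2 * B + 1))).
- apply: eq_Rintegral => t _; rewrite -RintegralZl//; last exact: slice_integrable.
  apply: eq_Rintegral => s _; rewrite mulrC; congr (w _ * _).
  transitivity (t * dot p p); last by rewrite p1 mulr1.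
  by rewrite /rotate /dot/=; ring.
- move=> x; apply: (@continuous_comp _ _ _ (rotate p) (fun x => u x * w (dot x p))).
    exact: continuous_rotate.
  exact: cF.
- move=> x; rewrite normrM -[leRHS]mulr1 ler_pM//; exact: lip_bound.
- by move=> x; rewrite mulf_eq0 negb_or => /andP[/rotate_support].
Qed.

Lemma integrable_plane_wave (w : R -> R) : continuous w -> (forall x, `|w x| <= 1) ->
  (lebesgue2 R).-integrable setT (EFin \o (fun x => u x * w (dot x p))).
Proof.
move=> cw w1.
have cd : continuous (fun x : R * R => dot x p).
  by move=> x; apply: cvgD; apply: cvgMr_tmp; [exact: cvg_fst|exact: cvg_snd].
apply: (@integrable_plane _ _ B (S * (2 * B + 1))).
- move=> x; apply: cvgM; first exact: lip_continuous.
  by apply: (@continuous_comp _ _ _ (fun x => dot x p) w); [exact: cd|exact: cw].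
- move=> x; rewrite normrM -[leRHS]mulr1 ler_pM//; exact: lip_bound.
- by move=> x; rewrite mulf_eq0 negb_or => /andP[/uB].
Qed.

End real_radon_theory.

Lemma normr_Re_cmod (R : realType) (z : R[i]) : `|complex.Re z| <= cmod z.
Proof. by rewrite /cmod -sqrtr_sqr ler_wsqrtr// lerDl sqr_ge0. Qed.

Lemma normr_Im_cmod (R : realType) (z : R[i]) : `|complex.Im z| <= cmod z.
Proof. by rewrite /cmod -sqrtr_sqr ler_wsqrtr// lerDr sqr_ge0. Qed.

Lemma cmod_le_ReIm (R : realType) (z : R[i]) :
  cmod z <= `|complex.Re z| + `|complex.Im z|.
Proof.
rewrite /cmod -[leRHS]ger0_norm ?addr_ge0// -sqrtr_sqr ler_wsqrtr//.
rewrite -[X in X + _ <= _]real_normK ?num_real// -[X in _ + X <= _]real_normK ?num_real//.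
by rewrite sqrrD -addrA [leRHS]addrCA lerDr mulrn_wge0// mulr_ge0.
Qed.

(** * Lipschitz bounds from the partial derivatives *)

Section C1_functions.
Context {R : realType}.
Implicit Types (v : R * R -> R) (e x : R * R).

Lemma is_derive_along v e x (h : R) : derivable v (h *: e + x) e ->
  is_derive h 1 (fun h => v (h *: e + x)) ('D_e v (h *: e + x)).
Proof.
move=> dv.
have E : (fun k : R => k^-1 *: (((fun h : R => v (h *: e + x)) \o shift h) (k *: 1) -
             (fun h : R => v (h *: e + x)) h)) =
         (fun k : R => k^-1 *: ((v \o shift (h *: e + x)) (k *: e) - v (h *: e + x))).
  by apply/funext => k /=; rewrite [k *: 1]mulr1 scalerDl addrA.
by split; rewrite /derivable /derive E.
Qed.

Lemma le_increment_along v e x (S a b : R) :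
  (forall y, derivable v y e) -> (forall y, `|'D_e v y| <= S) ->
  `|v (a *: e + x) - v (b *: e + x)| <= S * `|a - b|.
Proof.
move=> dv vS; wlog ab : a b / b <= a => [hw|].
  by case: (leP b a) => [|/ltW] /hw//; rewrite distrC [`|b - a|]distrC.
have [|c _ ->] := MVT_segment ab (fun h _ => is_derive_along (dv (h *: e + x))).
  apply: derivable_within_continuous => h _.
  by have [] := is_derive_along (dv (h *: e + x)).
by rewrite normrM ler_wpM2r.
Qed.

(** Go from [x] to [y] through $(y_1,x_2)$ and apply the mean value theorem on each of the two
    axis-parallel segments; neither is longer than the sup norm of [x - y]. *)
Lemma C1_real_lipschitz v (S1 S2 : R) : C1_real v ->
  (forall x, `|'D_(e1 R) v x| <= S1) -> (forall x, `|'D_(e2 R) v x| <= S2) ->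
  forall x y, `|v x - v y| <= (S1 + S2) * `|x - y|.
Proof.
move=> v1 h1 h2 x y.
have [d1 _] := v1 (e1 R) (or_introl erefl); have [d2 _] := v1 (e2 R) (or_intror erefl).
have E1 (a b : R) : a *: e1 R + (0, b) = (a, b).
  by apply: injective_projections; rewrite /= /GRing.scale/= ?mulr1 ?mulr0 ?addr0 ?add0r.
have E2 (a b : R) : b *: e2 R + (a, 0) = (a, b).
  by apply: injective_projections; rewrite /= /GRing.scale/= ?mulr1 ?mulr0 ?addr0 ?add0r.
have := le_increment_along (0, x.2) x.1 y.1 d1 h1; rewrite !E1 => l1.
have := le_increment_along (y.1, 0) x.2 y.2 d2 h2; rewrite !E2 => l2.
have S10 : 0 <= S1 := le_trans (normr_ge0 _) (h1 0).
have S20 : 0 <= S2 := le_trans (normr_ge0 _) (h2 0).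
case: x y l1 l2 => [x1 x2] [y1 y2] /= l1 l2.
apply: le_trans (ler_distD (v (y1, x2)) _ _) _; rewrite mulrDl.
apply: lerD; [apply: le_trans l1 _|apply: le_trans l2 _]; rewrite ler_wpM2l//.
  by rewrite prod_normE/= le_max lexx.
by rewrite prod_normE/= le_max lexx orbT.
Qed.

End C1_functions.

Section C1_compact_support.
Context {R : realType}.
Variables (phi : R * R -> R[i]) (N1 M1 N2 M2 : R).
Hypothesis phi_C1 : C1 phi.
Hypothesis phi_compact : compact (supp phi).
Hypothesis phi_supp : supp phi `<=` box N1 M1 N2 M2.

Let S1 := sup_norm_on (box N1 M1 N2 M2) (cderive phi (e1 R)).
Let S2 := sup_norm_on (box N1 M1 N2 M2) (cderive phi (e2 R)).

Lemma cderive_support e x : ~ supp phi x -> cderive phi e x = 0.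
Proof.
move=> sx.
have near0 : \forall y \near x, phi y = 0.
  have : open_nbhs x (~` supp phi).
    by split => //; apply: closed_openC; exact: closed_closure.
  move=> /open_nbhs_nbhs; apply: filterS => y sy; apply/eqP/negPn/negP => py.
  by apply: sy; exact: subset_closure.
have der0 (h : R[i] -> R) : h 0 = 0 -> 'D_e (fun y => h (phi y)) x = 0.
  move=> h0; rewrite (@near_eq_derive _ _ _ _ (cst 0)) ?derive_cst//.
  by apply: filterS near0 => y ->.
by rewrite /cderive !der0.
Qed.

(** Continuity gives a bound on the compact support, and the derivative vanishes off it. This bound
    makes [sup_norm_on] a true supremum and not a default value. *)
Lemma cderive_bounded e : e = e1 R \/ e = e2 R ->
  exists C : R, forall x, cmod (cderive phi e x) <= C.
Proof.
move=> ee; have [[_ cRe] [_ cIm]] := (phi_C1.1 e ee, phi_C1.2 e ee).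
have bd (w : R * R -> R) : continuous w -> exists C : R, forall x, supp phi x -> `|w x| <= C.
  move=> cw.
  have /compact_bounded[C [_ wC]] : compact (w @` supp phi).
    by apply: continuous_compact => //; exact: continuous_subspaceT.
  exists (C + 1) => x sx; apply: (wC (C + 1)); first by rewrite ltrDl.
  by exists x.
have [C1 hC1] := bd _ cRe; have [C2 hC2] := bd _ cIm.
exists (`|C1| + `|C2|) => x.
have [sx|/cderive_support ->] := pselect (supp phi x); last first.
  by rewrite /cmod/= !expr0n/= addr0 sqrtr0 addr_ge0.
apply: le_trans (cmod_le_ReIm _) _.
by apply: lerD; [apply: le_trans (hC1 _ sx) _|apply: le_trans (hC2 _ sx) _]; exact: ler_norm.
Qed.

Lemma sup_norm_cderive e x : e = e1 R \/ e = e2 R ->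
  cmod (cderive phi e x) <= sup_norm_on (box N1 M1 N2 M2) (cderive phi e).
Proof.
move=> ee; have [C hC] := cderive_bounded ee.
have ub : has_ubound [set cmod (cderive phi e x) | x in box N1 M1 N2 M2].
  by exists C => _ [y _ <-].
have [bx|bx] := pselect (box N1 M1 N2 M2 x).
  by apply: ub_le_sup => //; exists x.
rewrite cderive_support; last by move=> /phi_supp.
rewrite /cmod/= !expr0n/= addr0 sqrtr0 /sup_norm_on.
(* Over an empty box the supremum is 0 by convention, which still bounds the vanishing
   derivative. *)
have [->|/set0P[z bz]] := eqVneq (box N1 M1 N2 M2) set0; first by rewrite image_set0 sup0.
apply: (@le_trans _ _ (cmod (cderive phi e z))); first exact: sqrtr_ge0.
by apply: ub_le_sup => //; exists z.
Qed.

Lemma Re_lipschitz x y :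
  `|complex.Re (phi x) - complex.Re (phi y)| <= (S1 + S2) * `|x - y|.
Proof.
apply: (C1_real_lipschitz phi_C1.1) => z.
  by apply: le_trans (sup_norm_cderive z (or_introl erefl));
    exact: (normr_Re_cmod (cderive phi (e1 R) z)).
by apply: le_trans (sup_norm_cderive z (or_intror erefl));
  exact: (normr_Re_cmod (cderive phi (e2 R) z)).
Qed.

Lemma Im_lipschitz x y :
  `|complex.Im (phi x) - complex.Im (phi y)| <= (S1 + S2) * `|x - y|.
Proof.
apply: (C1_real_lipschitz phi_C1.2) => z.
  by apply: le_trans (sup_norm_cderive z (or_introl erefl));
    exact: (normr_Im_cmod (cderive phi (e1 R) z)).
by apply: le_trans (sup_norm_cderive z (or_intror erefl));
  exact: (normr_Im_cmod (cderive phi (e2 R) z)).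
Qed.

Lemma box_radius_support x : phi x != 0 ->
  `|x.1| <= box_radius N1 M1 N2 M2 /\ `|x.2| <= box_radius N1 M1 N2 M2.
Proof.
move=> px; have /phi_supp[/andP[h1 h2] /andP[h3 h4]] : supp phi x by exact: subset_closure.
have bd (a b t : R) : a <= t -> t <= b -> `|t| <= Num.max `|a| `|b|.
  move=> at_ tb; rewrite le_max; case: (lerP 0 t) => t0; apply/orP; [right|left].
    by rewrite ger0_norm// (le_trans tb)// ler_norm.
  by rewrite ltr0_norm// (@le_trans _ _ (- a)) ?lerN2// -normrN ler_norm.
by split; rewrite /box_radius le_max; apply/orP; [left|right]; exact: bd.
Qed.

End C1_compact_support.

(** * The smallest eigenvalue of a Hermitian matrix *)

Section rayleigh.
Context {R : realType} {m : nat} (A : 'M[R[i]]_m).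
Local Open Scope sesquilinear_scope.
Local Notation C := R[i].

Definition herm_form (v : 'rV[C]_m) : C := (v *m A *m v^t*) 0 0.

Hypothesis A_herm : A \is hermsymmx.
Hypothesis A_pos : forall v : 'rV[C]_m, v != 0 -> 0 < herm_form v.

Let P := spectralmx A.
Let d := spectral_diag A.

Let AE : A = P^t* *m diag_mx d *m P.
Proof.
rewrite -invmx_unitary ?spectral_unitarymx//.
exact/orthomx_spectralP/hermitian_normalmx.
Qed.

Lemma dot_conjE (v : 'rV[C]_m) : (v *m v^t*) 0 0 = \sum_i `|v 0 i| ^+ 2.
Proof. by rewrite mxE; apply: eq_bigr => i _; rewrite !mxE normCK. Qed.

(** The form is diagonal in the coordinates $vP^*$ of [v] with respect to the orthonormal eigenbasis
    formed by the rows of [P]. *)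
Lemma herm_form_diag (v : 'rV[C]_m) :
  herm_form v = \sum_i d 0 i * `|(v *m P^t*) 0 i| ^+ 2.
Proof.
rewrite /herm_form {1}AE.
have -> : v *m (P^t* *m diag_mx d *m P) *m v^t* =
   (v *m P^t*) *m diag_mx d *m (v *m P^t*)^t*.
  by rewrite trmx_mul map_mxM trmxCK !mulmxA.
rewrite mxE; apply: eq_bigr => i _.
by rewrite mul_mx_diag !mxE mulrAC mulrC normCK.
Qed.

Lemma herm_norm_unitary (v : 'rV[C]_m) :
  \sum_i `|v 0 i| ^+ 2 = \sum_i `|(v *m P^t*) 0 i| ^+ 2.
Proof.
rewrite -!dot_conjE trmx_mul map_mxM trmxCK mulmxA.
by rewrite mulmxKtV ?spectral_unitarymx.
Qed.

Let row_eigen i : row i P *m A = d 0 i *: row i P.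
Proof.
rewrite AE !mulmxA -row_mul (unitarymxP (spectral_unitarymx A)) row1.
rewrite -rowE row_diag_mx -scalemxAl.
by rewrite -rowE.
Qed.

Let row_unit i : (row i P *m (row i P)^t*) 0 0 = 1.
Proof.
transitivity ((P *m P^t*) i i).
  by rewrite !mxE; apply: eq_bigr => j _; rewrite !mxE.
by rewrite (unitarymxP (spectral_unitarymx A)) mxE eqxx.
Qed.

Let row_neq0 i : row i P != 0.
Proof.
by apply/eqP => r0; have := row_unit i; rewrite r0 mul0mx mxE => /esym/eqP; rewrite oner_eq0.
Qed.

Let d_gt0 i : 0 < d 0 i.
Proof.
have := A_pos (row_neq0 i).
by rewrite /herm_form row_eigen -scalemxAl mxE row_unit mulr1.
Qed.

Let dE i : d 0 i = (complex.Re (d 0 i))%:C.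
Proof. by have := d_gt0 i; rewrite ltcE/= => /andP[/eqP e _]; case: (d 0 i) e => a b /= ->. Qed.

Let Re_d_gt0 i : 0 < complex.Re (d 0 i).
Proof. by have := d_gt0 i; rewrite {1}dE ltcR. Qed.

(** Stated for any lower bound [mu] of the spectrum, because it is used first to locate the
    eigenvalues and only then with [mu] equal to [lambda_min A]. *)
Lemma herm_form_lower (mu : R) (v : 'rV[C]_m) : (forall i, mu <= complex.Re (d 0 i)) ->
  mu%:C * \sum_i `|v 0 i| ^+ 2 <= herm_form v.
Proof.
move=> mud; rewrite herm_form_diag herm_norm_unitary mulr_sumr ler_sum// => i _.
by rewrite ler_wpM2r ?exprn_ge0// dE lecR.
Qed.

(** At an eigenvector the form equals [a] times the squared norm, and that norm can be cancelled. *)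
Lemma eigenvalue_ge (mu a : R) : (forall i, mu <= complex.Re (d 0 i)) ->
  eigenvalue A a%:C -> mu <= a.
Proof.
move=> mud /eigenvalueP[v vA v0].
have := herm_form_lower v mud.
rewrite /herm_form vA -scalemxAl mxE dot_conjE ler_pM2r ?lecR//.
have /rV0Pn[i vi] := v0.
rewrite (bigD1 i)//= ltr_pwDl ?exprn_gt0 ?normr_gt0//.
by rewrite sumr_ge0// => j _; rewrite exprn_ge0.
Qed.

Lemma lambda_min_le i : lambda_min A <= complex.Re (d 0 i).
Proof.
(* Positivity bounds the eigenvalues below by 0, so that [inf] is a genuine lower bound. *)
apply: ge_inf; first exists 0 => a /=.
  by apply: eigenvalue_ge => j; exact/ltW.
by rewrite /= -dE; apply/eigenvalueP; exists (row i P).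
Qed.

Lemma herm_form_lambda_min (v : 'rV[C]_m) :
  (lambda_min A)%:C * \sum_i `|v 0 i| ^+ 2 <= herm_form v.
Proof. exact: herm_form_lower lambda_min_le. Qed.

(** An infimum of positive numbers may be 0; here the smallest diagonal entry is a positive lower
    bound. In size 0 there is no eigenvalue and the infimum takes the default value 0. *)
Lemma lambda_min_gt0 : (0 < m)%N -> 0 < lambda_min A.
Proof.
move=> m0; pose i0 := Ordinal m0.
have [i _ imin] : exists2 i : 'I_m, true & forall j, complex.Re (d 0 i) <= complex.Re (d 0 j).
  case: (@arg_minP _ _ _ i0 xpredT (fun j => complex.Re (d 0 j))) => // i _ h.
  by exists i => // j; exact: h.
apply: (lt_le_trans (Re_d_gt0 i)); apply: lb_le_inf.
  by exists (complex.Re (d 0 i)); rewrite /= -dE; apply/eigenvalueP; exists (row i P).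
by move=> a; exact: eigenvalue_ge.
Qed.

End rayleigh.

(** * Complex-valued integrals *)

Lemma ReM (R : realType) (x y : R[i]) :
  complex.Re (x * y) = complex.Re x * complex.Re y - complex.Im x * complex.Im y.
Proof. by case: x; case: y. Qed.

Lemma ImM (R : realType) (x y : R[i]) :
  complex.Im (x * y) = complex.Re x * complex.Im y + complex.Im x * complex.Re y.
Proof. by case: x; case: y. Qed.

Section complex_integral.
Context d (T : measurableType d) (R : realType) (mu : {measure set T -> \bar R}).
Implicit Types F G : T -> R[i].

Definition cintegrable F :=
  mu.-integrable setT (EFin \o (fun x => complex.Re (F x))) /\
  mu.-integrable setT (EFin \o (fun x => complex.Im (F x))).

Lemma cintegrableD F G : cintegrable F -> cintegrable G ->
  cintegrable (fun x => F x + G x).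
Proof.
move=> [F1 F2] [G1 G2]; split.
  rewrite (_ : _ \o _ = ((EFin \o (fun x => complex.Re (F x))) \+
    (EFin \o (fun x => complex.Re (G x))))%E); first exact: integrableD.
  by apply/funext => x /=; case: (F x); case: (G x).
rewrite (_ : _ \o _ = ((EFin \o (fun x => complex.Im (F x))) \+
    (EFin \o (fun x => complex.Im (G x))))%E); first exact: integrableD.
by apply/funext => x /=; case: (F x); case: (G x).
Qed.

Lemma cintegralD F G : cintegrable F -> cintegrable G ->
  cintegral mu (fun x => F x + G x) = cintegral mu F + cintegral mu G.
Proof.
move=> [F1 F2] [G1 G2]; apply/eqP; rewrite eq_complex /=; apply/andP; split; apply/eqP.
  rewrite -RintegralD//; apply: eq_Rintegral => x _ /=; by case: (F x); case: (G x).
rewrite -RintegralD//; apply: eq_Rintegral => x _ /=; by case: (F x); case: (G x).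
Qed.

Let integrableZ (f : T -> R) a : mu.-integrable setT (EFin \o f) ->
  mu.-integrable setT (EFin \o (fun x => a * f x)).
Proof. by move=> fi; have := integrableZl measurableT a fi; apply: eq_integrable. Qed.

Lemma cintegrableZ (z : R[i]) F : cintegrable F -> cintegrable (fun x => z * F x).
Proof.
move=> [F1 F2]; split.
  rewrite (_ : _ \o _ = ((EFin \o (fun x => (complex.Re z * complex.Re (F x))%R)) \-
    (EFin \o (fun x => (complex.Im z * complex.Im (F x))%R)))%E); last first.
    by apply/funext => x /=; rewrite ReM EFinB.
  by apply: integrableB => //; exact: integrableZ.
rewrite (_ : _ \o _ = ((EFin \o (fun x => (complex.Re z * complex.Im (F x))%R)) \+
    (EFin \o (fun x => (complex.Im z * complex.Re (F x))%R)))%E); last first.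
  by apply/funext => x /=; rewrite ImM EFinD.
by apply: integrableD => //; exact: integrableZ.
Qed.

Lemma cintegralZ (z : R[i]) F : cintegrable F ->
  cintegral mu (fun x => z * F x) = z * cintegral mu F.
Proof.
move=> [F1 F2]; apply/eqP; rewrite eq_complex ReM ImM /=; apply/andP; split; apply/eqP.
  rewrite -!RintegralZl// -RintegralB//; try exact: integrableZ.
  by apply: eq_Rintegral => x _; rewrite ReM.
rewrite -!RintegralZl// -RintegralD//; try exact: integrableZ.
by apply: eq_Rintegral => x _; rewrite ImM.
Qed.

Lemma cintegrable_sum (I : Type) (s : seq I) (F : I -> T -> R[i]) :
  (forall i, cintegrable (F i)) -> cintegrable (fun x => \sum_(i <- s) F i x).
Proof.
move=> Fi; elim: s => [|i s IHs].
  by split; under eq_fun do rewrite big_nil; exact: integrable0.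
by under eq_fun do rewrite big_cons; exact: cintegrableD.
Qed.

Lemma cintegral_sum (I : Type) (s : seq I) (F : I -> T -> R[i]) :
  (forall i, cintegrable (F i)) ->
  cintegral mu (fun x => \sum_(i <- s) F i x) = \sum_(i <- s) cintegral mu (F i).
Proof.
move=> Fi; elim: s => [|i s IHs].
  rewrite big_nil; under eq_fun do rewrite big_nil.
  by rewrite /cintegral !Rintegral_cst//= !mul0r.
rewrite big_cons -IHs; under eq_fun do rewrite big_cons.
by rewrite cintegralD//; exact: cintegrable_sum.
Qed.

End complex_integral.

(** * Bounded continuous functions of compact support on the line *)

Section line_functions.
Context {R : realType}.
Implicit Types (u v : R -> R) (F G : R -> R[i]).
Local Notation mu := (@lebesgue_measure R).

Definition line_test u := [/\ continuous u, exists C, forall x, `|u x| <= C &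
  exists B, forall x, u x != 0 -> `|x| <= B].

Lemma line_testD u v : line_test u -> line_test v -> line_test (fun x => u x + v x).
Proof.
move=> [cu [C uC] [B uB]] [cv [D vD] [B' vB]]; split.
- by move=> x; apply: cvgD; [exact: cu|exact: cv].
- by exists (C + D) => x; apply: le_trans (ler_normD _ _) _; exact: lerD.
- exists (Num.max B B') => x; rewrite le_max; have [-> vx|/uB ->//] := eqVneq (u x) 0.
  by rewrite vB ?orbT//; rewrite add0r in vx.
Qed.

Lemma line_testM u v : line_test u -> line_test v -> line_test (fun x => u x * v x).
Proof.
move=> [cu [C uC] [B uB]] [cv [D vD] [B' vB]]; split.
- by move=> x; apply: cvgM; [exact: cu|exact: cv].
- by exists (C * D) => x; rewrite normrM; exact: ler_pM.
- by exists B => x; rewrite mulf_eq0 negb_or => /andP[/uB].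
Qed.

Lemma line_testN u : line_test u -> line_test (fun x => - u x).
Proof.
move=> [cu [C uC] [B uB]]; split.
- by move=> x; apply: cvgN; exact: cu.
- by exists C => x; rewrite normrN.
- by exists B => x; rewrite oppr_eq0 => /uB.
Qed.

Lemma line_test0 : line_test (fun=> 0).
Proof.
split; first by move=> x; exact: cvg_cst.
  by exists 0 => x; rewrite normr0.
by exists 0 => x; rewrite eqxx.
Qed.

Lemma line_testZ a u : line_test u -> line_test (fun x => a * u x).
Proof.
move=> [cu [C uC] [B uB]]; split.
- by move=> x; apply: cvgMl_tmp; exact: cu.
- by exists (`|a| * C) => x; rewrite normrM; exact: ler_pM.
- by exists B => x; rewrite mulf_eq0 negb_or => /andP[_ /uB].
Qed.

Lemma line_test_translate a u : line_test u -> line_test (fun x => u (x - a)).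
Proof.
move=> [cu [C uC] [B uB]]; split.
- move=> x; apply: (@continuous_comp _ _ _ (fun x => x - a) u); last exact: cu.
  by apply: cvgB; [exact: cvg_id|exact: cvg_cst].
- by exists C.
- exists (B + `|a|) => x /uB xB; rewrite -[x](subrK a).
  by apply: le_trans (ler_normD _ _) _; rewrite lerD2r.
Qed.

Lemma line_test_integrable u : line_test u -> mu.-integrable setT (EFin \o u).
Proof.
move=> [cu [C uC] [B uB]]; have H := @integrable_line _ u (- B) B C cu uC.
by apply: H => x /uB; rewrite ler_norml.
Qed.

(* A nonnegative continuous function is at least half its value at a point on
   an interval around that point. *)
Lemma line_test_integral_eq0 u : line_test u -> (forall x, 0 <= u x) ->
  \int[mu]_x u x = 0 -> forall x, u x = 0.
Proof.
move=> tu u0 iu x; apply/eqP/negPn/negP => ux.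
have ux0 : 0 < u x by rewrite lt_def ux u0.
have iint := line_test_integrable tu.
have [cu _ _] := tu.
have /cvgrPdist_lt/(_ (u x / 2)) : u y @[y --> x] --> u x by exact: cu.
rewrite divr_gt0// => /(_ isT) [e /= e0 he].
pose A : set (measurableTypeR R) := `]x - e, x + e[%classic.
have mA : measurable A by exact: measurable_itv.
have Ah y : A y -> u x / 2 <= u y.
  rewrite /A /= in_itv/= => /andP[y1 y2].
  have /he : ball x e y by rewrite /ball/= ltr_norml; apply/andP; split; lra.
  by rewrite /= ltr_norml => /andP[_ ?]; lra.
suff : 0 < \int[mu]_x u x by rewrite iu ltxx.
have iA : mu.-integrable A (EFin \o u) by apply: integrableS iint.
have cA : mu.-integrable A (EFin \o cst (u x / 2)).
  apply: measurable_bounded_integrable => //; last exact: bounded_cst.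
  by rewrite /A /= lebesgue_measure_itv/=; case: ifP => // _; rewrite ltry.
apply: (@lt_le_trans _ _ (\int[mu]_(y in A) (u x / 2))).
  rewrite Rintegral_cst// /A /= lebesgue_measure_itv/= lte_fin.
  have -> : x - e < x + e by lra.
  by rewrite /=; apply: mulr_gt0; lra.
apply: (@le_trans _ _ (\int[mu]_(y in A) u y)); first exact: le_Rintegral.
rewrite [leLHS]Rintegral_mkcond.
have iAT : mu.-integrable setT (EFin \o (u \_ A)).
  by have := iA; rewrite (integrable_mkcond _ mA) restrict_EFin.
apply: le_Rintegral => // y _; rewrite /patch; case: ifP => // _; exact: u0.
Qed.

Definition line_ctest F :=
  line_test (fun x => complex.Re (F x)) /\ line_test (fun x => complex.Im (F x)).

Lemma line_ctestD F G : line_ctest F -> line_ctest G -> line_ctest (fun x => F x + G x).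
Proof.
move=> [F1 F2] [G1 G2]; split.
  rewrite (_ : (fun _ => _) = (fun x => complex.Re (F x) + complex.Re (G x))).
    exact: line_testD.
  by apply/funext => x; case: (F x); case: (G x).
rewrite (_ : (fun _ => _) = (fun x => complex.Im (F x) + complex.Im (G x))).
  exact: line_testD.
by apply/funext => x; case: (F x); case: (G x).
Qed.

Lemma line_ctestM F G : line_ctest F -> line_ctest G -> line_ctest (fun x => F x * G x).
Proof.
move=> [F1 F2] [G1 G2]; split.
  under eq_fun do rewrite ReM.
  by apply: line_testD; [exact: line_testM|apply: line_testN; exact: line_testM].
under eq_fun do rewrite ImM.
by apply: line_testD; exact: line_testM.
Qed.

Lemma line_ctestZ z F : line_ctest F -> line_ctest (fun x => z * F x).
Proof.
move=> [F1 F2]; split.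
  under eq_fun do rewrite ReM.
  by apply: line_testD; [exact: line_testZ|apply: line_testN; exact: line_testZ].
under eq_fun do rewrite ImM.
by apply: line_testD; exact: line_testZ.
Qed.

Lemma line_ctest_conj F : line_ctest F -> line_ctest (fun x => conjc (F x)).
Proof.
move=> [F1 F2]; split.
  by rewrite (_ : (fun _ => _) = (fun x => complex.Re (F x)))//; apply/funext => x; case: (F x).
rewrite (_ : (fun _ => _) = (fun x => - complex.Im (F x))); first exact: line_testN.
by apply/funext => x; case: (F x).
Qed.

Lemma line_ctest_translate a F : line_ctest F -> line_ctest (fun x => F (x - a)).
Proof.
by move=> [F1 F2]; split; [exact: (line_test_translate a F1)|exact: (line_test_translate a F2)].
Qed.

Lemma line_ctest_sum (I : Type) (s : seq I) (F : I -> R -> R[i]) :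
  (forall i, line_ctest (F i)) -> line_ctest (fun x => \sum_(i <- s) F i x).
Proof.
move=> Fi; elim: s => [|i s IHs].
  by split; under eq_fun do rewrite big_nil; exact: line_test0.
by under eq_fun do rewrite big_cons; exact: line_ctestD.
Qed.

Lemma line_ctest_integrable F : line_ctest F -> cintegrable mu F.
Proof. by move=> [F1 F2]; split; apply: line_test_integrable. Qed.

End line_functions.

(** * Translates of a compactly supported function *)

Lemma cmod_sqr (R : realType) (z : R[i]) :
  cmod z ^+ 2 = complex.Re z ^+ 2 + complex.Im z ^+ 2.
Proof. by rewrite /cmod sqr_sqrtr// addr_ge0// sqr_ge0. Qed.

Lemma cmod_sqr_eq0 (R : realType) (z : R[i]) : cmod z ^+ 2 = 0 -> z = 0.
Proof.
rewrite cmod_sqr => /eqP; rewrite paddr_eq0 ?sqr_ge0// !sqrf_eq0.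
by case: z => a b /= /andP[/eqP-> /eqP->].
Qed.

Lemma normC_cmod (R : realType) (z : R[i]) : `|z| = (cmod z)%:C.
Proof. exact: normc_def. Qed.

(** Cauchy-Schwarz against the constant vector 1, from $a_ia_j\le(a_i^2+a_j^2)/2$. *)
Lemma sqr_sum_le (R : realType) (m : nat) (a : 'I_m -> R) :
  (\sum_j a j) ^+ 2 <= m%:R * \sum_j a j ^+ 2.
Proof.
rewrite expr2 big_distrlr /=.
apply: (@le_trans _ _ (\sum_(i < m) \sum_(j < m) (a i ^+ 2 / 2 + a j ^+ 2 / 2))).
  apply: ler_sum => i _; apply: ler_sum => j _.
  by have := sqr_ge0 (a i - a j); nra.
set T := \sum_j a j ^+ 2.
rewrite (eq_bigr (fun i => m%:R * (a i ^+ 2 / 2) + T / 2)) => [|i _].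
  rewrite big_split /= sumr_const card_ord -mulr_sumr -mulr_suml -/T.
  by rewrite -[T / 2 *+ m]mulr_natl -mulrDr -splitr.
by rewrite big_split /= sumr_const card_ord -mulr_suml mulr_natl.
Qed.

(* Test the relation at a point where the translate of largest shift is nonzero,
   within the smallest gap of the supremum of its support. *)
Lemma translates_independent (R : realType) (rho : R -> R[i]) (c x0 : R) (m : nat)
    (tau : 'I_m -> R) (v : 'I_m -> R[i]) :
  injective tau -> (forall x, rho x != 0 -> `|x| <= c) -> rho x0 != 0 ->
  (forall x, \sum_j v j * rho (x - tau j) = 0) -> forall j, v j = 0.
Proof.
move=> tau_inj rho_c rho_x0 v0 j1; apply/eqP/negPn/negP => vj1.
have [j vj jmax] : exists2 j, v j != 0 & forall i, v i != 0 -> tau i <= tau j.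
  by case: (@arg_maxP _ _ _ j1 (fun i => v i != 0) tau vj1) => j ? ?; exists j.
pose S := [set x | rho x != 0].
have supS : has_sup S.
  split; first by exists x0.
  by exists c => x /rho_c; rewrite ler_norml => /andP[].
(* The default 1 keeps [e] positive when no shift lies below [tau j]. *)
pose e := \big[Order.min/1]_(i | tau i < tau j) (tau j - tau i).
have e0 : 0 < e by apply: lt_bigmin => // i; rewrite subr_gt0.
have [t St te] := sup_adherent e0 supS.
have := v0 (t + tau j); rewrite (bigD1 j)//= big1 ?addr0 => [|i ij].
  by rewrite addrK => /eqP; rewrite mulf_eq0 (negbTE vj) (negbTE St).
have [->|vi] := eqVneq (v i) 0; first by rewrite mul0r.
have tij : tau i < tau j.
  by rewrite lt_neqAle jmax// andbT; apply: contra ij => /eqP/tau_inj->.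
(* Otherwise [t + tau j - tau i] would belong to [S], although it exceeds [sup S] because [t] is
   within [e] of it. *)
apply/eqP; rewrite mulf_eq0 (negbTE vi) /=; apply/negPn/negP => Si.
have : t + tau j - tau i <= sup S by apply: ub_le_sup Si; exact: supS.2.
have : e <= tau j - tau i by exact: bigmin_le_cond.
by lra.
Qed.

Section translates_gram.
Context {R : realType} {m : nat}.
Variables (rho : R -> R[i]) (c x0 : R) (tau : 'I_m -> R).
Local Open Scope sesquilinear_scope.
Local Notation mu := (@lebesgue_measure R).

Hypothesis rho_test : line_ctest rho.
Hypothesis rho_c : forall x, rho x != 0 -> `|x| <= c.
Hypothesis rho_x0 : rho x0 != 0.
Hypothesis tau_inj : injective tau.

Definition translates_gram : 'M[R[i]]_m :=
  \matrix_(j, n) cintegral mu (fun x => rho (x - tau j) * conjc (rho (x - tau n))).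

Definition translates_comb (v : 'rV[R[i]]_m) (x : R) : R[i] :=
  \sum_j v 0 j * rho (x - tau j).

Local Notation G := translates_gram.
Local Notation g := translates_comb.

Lemma translates_comb_test v : line_ctest (g v).
Proof. by apply: line_ctest_sum => j; apply/line_ctestZ/line_ctest_translate. Qed.

Let pair_test j n : line_ctest (fun x => rho (x - tau j) * conjc (rho (x - tau n))).
Proof.
by apply: line_ctestM; [|apply: line_ctest_conj]; exact: line_ctest_translate.
Qed.

Lemma translates_gram_herm : G \is hermsymmx.
Proof.
apply/is_hermitianmxP; rewrite expr0 scale1r; apply/matrixP => j n; rewrite !mxE.
rewrite [RHS](_ : _ = conjc (cintegral mu (fun x => rho (x - tau n) * conjc (rho (x - tau j)))))//.
rewrite /cintegral/=; apply/eqP; rewrite eq_complex /=; apply/andP; split; apply/eqP.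
  by apply: eq_Rintegral => x _; case: (rho _) => a b; case: (rho _) => a' b' /=; ring.
rewrite -[RHS]mulN1r -RintegralZl//; last first.
  by have [_] := line_ctest_integrable (pair_test n j).
by apply: eq_Rintegral => x _; case: (rho _) => a b; case: (rho _) => a' b' /=; ring.
Qed.

(** Expand $g\bar g$ and move the finite double sum out of the integral. Through this identity the
    smallest eigenvalue bounds $\int|g|^2$ from below. *)
Lemma herm_form_gram v : herm_form G v = (\int[mu]_x (cmod (g v x) ^+ 2))%:C.
Proof.
transitivity (cintegral mu (fun x => g v x * conjc (g v x))).
  rewrite /herm_form mxE.
  transitivity (cintegral mu (fun x =>
    \sum_n \sum_j (v 0 j * conjc (v 0 n)) * (rho (x - tau j) * conjc (rho (x - tau n))))).
    rewrite cintegral_sum => [|n]; last first.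
      by apply: cintegrable_sum => j; apply/cintegrableZ/line_ctest_integrable/pair_test.
    apply: eq_bigr => n _; rewrite cintegral_sum => [|j]; last first.
      by apply/cintegrableZ/line_ctest_integrable/pair_test.
    rewrite !mxE mulr_suml; apply: eq_bigr => j _.
    rewrite cintegralZ; last exact/line_ctest_integrable/pair_test.
    by rewrite !mxE mulrAC.
  congr cintegral; apply/funext => x; rewrite /translates_comb rmorph_sum mulr_sumr.
  apply: eq_bigr => n _; rewrite mulr_suml; apply: eq_bigr => j _.
  by rewrite rmorphM mulrACA.
apply/eqP; rewrite eq_complex /=; apply/andP; split; apply/eqP.
  by apply: eq_Rintegral => x _; rewrite cmod_sqr; case: (g v x) => a b /=; ring.
rewrite (eq_Rintegral _ (g := cst 0)) ?Rintegral_cst ?mul0r// => x _.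
by case: (g v x) => a b /=; ring.
Qed.

Lemma cmod_test v : line_test (fun x => cmod (g v x) ^+ 2).
Proof.
have [h1 h2] := translates_comb_test v.
under eq_fun do rewrite cmod_sqr !expr2.
by apply: line_testD; exact: line_testM.
Qed.

Lemma translates_gram_pos v : v != 0 -> 0 < herm_form G v.
Proof.
move=> v0; rewrite herm_form_gram ltcR lt_def Rintegral_ge0 ?andbT; last first.
  by move=> x _; exact: sqr_ge0.
apply: contra v0 => /eqP iv0; apply/eqP/rowP => j; rewrite mxE.
apply: (translates_independent tau_inj rho_c rho_x0) => x.
apply: cmod_sqr_eq0.
by apply: (line_test_integral_eq0 (cmod_test v)) => // y; exact: sqr_ge0.
Qed.

Section sampling.
Variables (Lam L U delta : R).
Hypothesis m0 : (0 < m)%N.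
Hypothesis Re_lip : forall x y, `|complex.Re (rho x) - complex.Re (rho y)| <= Lam * `|x - y|.
Hypothesis Im_lip : forall x y, `|complex.Im (rho x) - complex.Im (rho y)| <= Lam * `|x - y|.
Hypothesis Lam0 : 0 <= Lam.
Hypothesis LU : L < U.
Hypothesis tau_LU : forall j, L <= tau j - c /\ tau j + c <= U.
Hypothesis delta0 : 0 < delta.
Hypothesis delta_small :
  (U - L) * (Lam ^+ 2 * delta ^+ 2 / 2 * m%:R) < lambda_min G.

Lemma comb_support v x : g v x != 0 -> L <= x <= U.
Proof.
apply: contraNT => xLU; rewrite /translates_comb big1// => j _.
suff -> : rho (x - tau j) = 0 by rewrite mulr0.
apply/eqP/negPn/negP => /rho_c; rewrite ler_norml => /andP[h1 h2].
move/negP: xLU; apply; have [h3 h4] := tau_LU j.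
by apply/andP; split; lra.
Qed.

(** Subtracting $g(y)=0$ leaves only increments of [rho]. Their real and imaginary parts are at most
    [Lam * (delta / 2)], so their modulus is at most [D]; the factor [m] comes from
    Cauchy-Schwarz. *)
Lemma comb_near_zero v x y : g v y = 0 -> `|x - y| <= delta / 2 ->
  cmod (g v x) ^+ 2 <= Lam ^+ 2 * delta ^+ 2 / 2 * m%:R * \sum_j cmod (v 0 j) ^+ 2.
Proof.
move=> gy xy; pose D := Num.sqrt (Lam ^+ 2 * delta ^+ 2 / 2).
have D2 : D ^+ 2 = Lam ^+ 2 * delta ^+ 2 / 2.
  by rewrite sqr_sqrtr// divr_ge0// mulr_ge0// sqr_ge0.
have rhoD j : cmod (rho (x - tau j) - rho (y - tau j)) <= D.
  rewrite /cmod ler_wsqrtr//.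
  have sq (a : R) : `|a| <= Lam * (delta / 2) -> a ^+ 2 <= Lam ^+ 2 * delta ^+ 2 / 4.
    move=> ha; rewrite -[a ^+ 2]real_normK ?num_real//.
    have -> : Lam ^+ 2 * delta ^+ 2 / 4 = (Lam * (delta / 2)) ^+ 2 by field.
    by rewrite ler_pXn2r// nnegrE ?mulr_ge0// ltW// divr_gt0.
  have xyj : `|x - tau j - (y - tau j)| <= delta / 2.
    by have -> : x - tau j - (y - tau j) = x - y by ring.
  have h1 : `|complex.Re (rho (x - tau j)) - complex.Re (rho (y - tau j))| <= Lam * (delta / 2).
    by apply: le_trans (Re_lip _ _) _; exact: ler_wpM2l.
  have h2 : `|complex.Im (rho (x - tau j)) - complex.Im (rho (y - tau j))| <= Lam * (delta / 2).
    by apply: le_trans (Im_lip _ _) _; exact: ler_wpM2l.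
  have := sq _ h1; have := sq _ h2.
  by case: (rho (x - tau j)) => a b; case: (rho (y - tau j)) => a' b' /=; lra.
have gD : cmod (g v x) <= D * \sum_j cmod (v 0 j).
  rewrite -lecR -normC_cmod.
  have -> : g v x = \sum_j v 0 j * (rho (x - tau j) - rho (y - tau j)).
    by under eq_bigr do rewrite mulrBr; rewrite sumrB -!/(g v _) gy subr0.
  apply: le_trans (ler_norm_sum _ _ _) _.
  rewrite rmorphM rmorph_sum mulr_sumr; apply: ler_sum => j _.
  by rewrite normrM !normC_cmod mulrC ler_wpM2r ?lecR// sqrtr_ge0.
apply: (@le_trans _ _ ((D * \sum_j cmod (v 0 j)) ^+ 2)).
  rewrite ler_pXn2r// nnegrE ?sqrtr_ge0// mulr_ge0 ?sqrtr_ge0//.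
  by apply: sumr_ge0 => j _; exact: sqrtr_ge0.
by rewrite exprMn D2 -[leRHS]mulrA ler_wpM2l ?sqr_sum_le// divr_ge0// mulr_ge0// sqr_ge0.
Qed.

Lemma comb_sampling v :
  (forall x, L <= x <= U -> exists y, g v y = 0 /\ `|x - y| <= delta / 2) -> v = 0.
Proof.
move=> gY; set N := \sum_j cmod (v 0 j) ^+ 2.
have N0 : 0 <= N by apply: sumr_ge0 => j _; exact: sqr_ge0.
have [cq _ _] := cmod_test v.
have up : \int[mu]_x (cmod (g v x) ^+ 2) <=
    (U - L) * (Lam ^+ 2 * delta ^+ 2 / 2 * m%:R * N).
  apply: le_trans (ler_norm _) _; apply: le_Rintegral_support => //; first exact: ltW.
    move=> x; rewrite ger0_norm ?sqr_ge0//.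
    have [g0|/comb_support/gY[y [gy xy]]] := eqVneq (g v x) 0; last exact: comb_near_zero xy.
    rewrite g0 /cmod /= expr0n/= addr0 sqrtr0 expr0n/=.
    by rewrite mulr_ge0// mulr_ge0// divr_ge0// mulr_ge0// sqr_ge0.
  by move=> x; rewrite sqrf_eq0 => gx; apply: (@comb_support v); apply: contraNneq gx => ->;
    rewrite /cmod /= expr0n/= addr0 sqrtr0.
have := herm_form_lambda_min translates_gram_herm translates_gram_pos v.
have -> : \sum_i `|v 0 i| ^+ 2 = N%:C.
  by rewrite rmorph_sum; apply: eq_bigr => j _; rewrite normC_cmod rmorphXn.
rewrite herm_form_gram -rmorphM lecR => lo.
have N_eq0 : N = 0.
  apply/eqP; rewrite eq_le N0 andbT leNgt; apply/negP => Ngt0.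
  have : (U - L) * (Lam ^+ 2 * delta ^+ 2 / 2 * m%:R) * N < lambda_min G * N.
    by rewrite ltr_pM2r.
  by rewrite ltNge (le_trans lo)// -mulrA.
apply/rowP => j; rewrite mxE; apply: cmod_sqr_eq0; apply/eqP.
have /eqP := N_eq0; rewrite psumr_eq0 => [/allP/(_ j)|i _]; last exact: sqr_ge0.
by apply; rewrite mem_index_enum.
Qed.

End sampling.
End translates_gram.

(** * Sampling the Radon transform *)

(** The ceiling in [K] makes the step [h] at most [delta], and rounding [(x - L) / h] to the nearest
    integer costs at most half a step. *)
Lemma grid_near (R : realType) (L U delta x : R) :
  L < U -> 0 < delta -> L <= x <= U ->
  let K := Num.ceil ((U - L) / delta) in
  exists2 l : int, 1 <= l <= K + 1 &
    `|x - (L + (U - L) / K%:~R * (l - 1)%:~R)| <= delta / 2.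
Proof.
move=> LU d0 /andP[Lx xU] K.
have UL0 : 0 < U - L by rewrite subr_gt0.
have K0 : (0 : R) < K%:~R by rewrite (lt_le_trans _ (ceil_ge _))// divr_gt0.
have K0' : 0 < K by rewrite -(ltr0z R).
pose h := (U - L) / K%:~R.
have h0 : 0 < h by rewrite divr_gt0.
have hd : h <= delta.
  by rewrite /h ler_pdivrMr// mulrC -ler_pdivrMr// ceil_ge.
pose n := Num.floor ((x - L) / h + 1 / 2).
have n1 : n%:~R <= (x - L) / h + 1 / 2 := floor_le _.
have n2 : (x - L) / h + 1 / 2 < n%:~R + 1 by rewrite -[1 in X in _ < X]/(1%:~R) -intrD floorD1_gt.
have xh0 : 0 <= (x - L) / h by rewrite divr_ge0// ?subr_ge0// ltW.
have xhK : (x - L) / h <= K%:~R.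
  by rewrite ler_pdivrMr// /h mulrC divfK ?gt_eqF// lerB.
have n0 : 0 <= n.
  by rewrite -ltzD1 -(ltr0z R) intrD; lra.
have nK : n <= K.
  by rewrite -ltzD1 -(ltr_int R) intrD; lra.
(* The grid is numbered from 1, while [n] counts steps from [L]. *)
exists (n + 1); first by rewrite lerDr n0 lerD2r.
rewrite addrK -/h.
have -> : x - (L + h * n%:~R) = h * ((x - L) / h - n%:~R) by field; rewrite gt_eqF.
rewrite normrM gtr0_norm//.
apply: (@le_trans _ _ (h * (1 / 2))); last by lra.
rewrite ler_pM2l// ler_norml; apply/andP; split; lra.
Qed.

(** * The Radon transform of [phi]: slice identity and translates *)

Section directions.
Context {R : realType}.
Variables (p : R * R) (phi : R * R -> R[i]) (S B : R).
Hypothesis p1 : dot p p = 1.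
Hypothesis Re_lip : forall x y, `|complex.Re (phi x) - complex.Re (phi y)| <= S * `|x - y|.
Hypothesis Im_lip : forall x y, `|complex.Im (phi x) - complex.Im (phi y)| <= S * `|x - y|.
Hypothesis phi_B : forall x, phi x != 0 -> `|x.1| <= B /\ `|x.2| <= B.
Hypothesis B0 : 0 <= B.
Hypothesis S0 : 0 <= S.

Let Re_B x : complex.Re (phi x) != 0 -> `|x.1| <= B /\ `|x.2| <= B.
Proof. by move=> h; apply: phi_B; apply: contraNneq h => ->. Qed.

Let Im_B x : complex.Im (phi x) != 0 -> `|x.1| <= B /\ `|x.2| <= B.
Proof. by move=> h; apply: phi_B; apply: contraNneq h => ->. Qed.

(** On the line spanned by [p] the phase is [a * dot x p], so each of the four real integrals that
    make up [fourier] is a plane-wave integral against a vanishing transform. *)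
Lemma fourier_slice_eq0 (a : R) : (forall t, radon p phi t = 0) ->
  fourier phi (a * p.1, a * p.2) = 0.
Proof.
move=> r0.
have dE (x : R * R) : dot x (a * p.1, a * p.2) = a * dot x p by rewrite /dot /=; ring.
have cc : continuous (fun y : R => cos (a * y)).
  move=> y; apply: (@continuous_comp _ _ _ ( *%R a) (@cos R)).
    exact: mulrl_continuous.
  exact: continuous_cos.
have cs : continuous (fun y : R => sin (a * y)).
  move=> y; apply: (@continuous_comp _ _ _ ( *%R a) (@sin R)).
    exact: mulrl_continuous.
  exact: continuous_sin.
have bc (y : R) : `|cos (a * y)| <= 1 by rewrite ler_norml cos_geN1 cos_le1.
have bs (y : R) : `|sin (a * y)| <= 1 by rewrite ler_norml sin_geN1 sin_le1.
have rRe t : real_radon p (fun x => complex.Re (phi x)) t = 0.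
  by have := congr1 (@complex.Re R) (r0 t).
have rIm t : real_radon p (fun x => complex.Im (phi x)) t = 0.
  by have := congr1 (@complex.Im R) (r0 t).
have w0 (u : R * R -> R) (w : R -> R) :
    (forall x y, `|u x - u y| <= S * `|x - y|) ->
    (forall x, u x != 0 -> `|x.1| <= B /\ `|x.2| <= B) ->
    (forall t, real_radon p u t = 0) -> continuous w -> (forall x, `|w x| <= 1) ->
    \int[lebesgue2 R]_x (u x * w (dot x p)) = 0.
  move=> uL uB ur cw bw; rewrite (integral_plane_wave p1 uL uB)//.
  by under eq_Rintegral do rewrite ur mulr0; rewrite Rintegral_cst// mul0r.
apply/eqP; rewrite eq_complex /fourier /cintegral /=; apply/andP; split; apply/eqP.
  transitivity (\int[lebesgue2 R]_x (complex.Re (phi x) * cos (a * dot x p)) +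
                \int[lebesgue2 R]_x (complex.Im (phi x) * sin (a * dot x p))).
    rewrite -RintegralD//.
    - apply: eq_Rintegral => x _; rewrite dE; case: (phi x) => b d /=; ring.
    - exact: (integrable_plane_wave Re_lip Re_B B0 S0 cc bc).
    - exact: (integrable_plane_wave Im_lip Im_B B0 S0 cs bs).
  by rewrite (w0 _ _ Re_lip Re_B rRe cc bc) (w0 _ _ Im_lip Im_B rIm cs bs) addr0.
transitivity (\int[lebesgue2 R]_x (complex.Im (phi x) * cos (a * dot x p)) -
              \int[lebesgue2 R]_x (complex.Re (phi x) * sin (a * dot x p))).
  rewrite -RintegralB//.
  - apply: eq_Rintegral => x _; rewrite dE; case: (phi x) => b d /=; ring.
  - exact: (integrable_plane_wave Im_lip Im_B B0 S0 cc bc).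
  - exact: (integrable_plane_wave Re_lip Re_B B0 S0 cs bs).
by rewrite (w0 _ _ Im_lip Im_B rIm cc bc) (w0 _ _ Re_lip Re_B rRe cs bs) subr0.
Qed.

Local Notation c := (Num.sqrt 2 * B).

Lemma radon_support t : radon p phi t != 0 -> `|t| <= c.
Proof.
rewrite radonE eq_complex negb_and /= => /orP[].
  exact: (real_radon_support p1 Re_B B0).
exact: (real_radon_support p1 Im_B B0).
Qed.

Lemma radon_Re_lipschitz x y :
  `|complex.Re (radon p phi x) - complex.Re (radon p phi y)| <= 2 * c * S * `|x - y|.
Proof. exact: (real_radon_lipschitz p1 Re_lip Re_B B0 S0). Qed.

Lemma radon_Im_lipschitz x y :
  `|complex.Im (radon p phi x) - complex.Im (radon p phi y)| <= 2 * c * S * `|x - y|.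
Proof. exact: (real_radon_lipschitz p1 Im_lip Im_B B0 S0). Qed.

Lemma radon_test : line_ctest (radon p phi).
Proof.
split; split.
- exact: (real_radon_continuous p1 Re_lip Re_B B0 S0).
- by exists (2 * c * (S * (2 * B + 1))) => x; exact: (real_radon_bound p1 Re_lip Re_B B0 S0).
- by exists c => x; exact: (real_radon_support p1 Re_B B0).
- exact: (real_radon_continuous p1 Im_lip Im_B B0 S0).
- by exists (2 * c * (S * (2 * B + 1))) => x; exact: (real_radon_bound p1 Im_lip Im_B B0 S0).
- by exists c => x; exact: (real_radon_support p1 Im_B B0).
Qed.

Lemma slice_ctest t : line_ctest (fun s => phi (rotate p (t, s))).
Proof.
split; split.
- exact: (slice_continuous Re_lip).
- by exists (S * (2 * B + 1)) => s; exact: (lip_bound Re_lip Re_B B0 S0).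
- by exists c => s /(slice_support p1 Re_B B0); rewrite ler_norml.
- exact: (slice_continuous Im_lip).
- by exists (S * (2 * B + 1)) => s; exact: (lip_bound Im_lip Im_B B0 S0).
- by exists c => s /(slice_support p1 Im_B B0); rewrite ler_norml.
Qed.

(** Split [z] along [p] and along the line of integration: the first component moves [t] by
    [dot p z], the second moves [s] by [a] and is absorbed by translation invariance. *)
Lemma radon_translate (z : R * R) t :
  cintegrable (@lebesgue_measure R) (fun s => phi (rotate p (t, s) - z)) /\
  radon p (fun x => phi (x - z)) t = radon p phi (t - dot p z).
Proof.
pose a := p.2 * z.1 - p.1 * z.2; pose h s := phi (rotate p (t - dot p z, s)).
have h_test : line_ctest h := slice_ctest _.
have E s : phi (rotate p (t, s) - z) = h (s + a).
  congr phi; rewrite /rotate /a /=; case: (z) => z1 z2 /=.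
  have pp : p.1 * p.1 + p.2 * p.2 = 1 := p1.
  apply: injective_projections; rewrite /= /dot/=.
    transitivity (t * p.1 - s * p.2 - z1 * (p.1 * p.1 + p.2 * p.2)); last by ring.
    by rewrite pp mulr1.
  transitivity (t * p.2 + s * p.1 - z2 * (p.1 * p.1 + p.2 * p.2)); last by ring.
  by rewrite pp mulr1.
split.
  rewrite (_ : (fun _ => _) = (fun s => h (s - - a))).
    by apply: line_ctest_integrable; exact: line_ctest_translate.
  by apply/funext => s; rewrite opprK E.
have [[cRe _ _] [cIm _ _]] := h_test.
rewrite /radon /cintegral; congr Complex.
  rewrite -[RHS](@Rintegral_translation _ a (fun s => complex.Re (h s))).
    by apply: eq_Rintegral => s _; rewrite -E.
  exact: continuous_measurable_fun.
rewrite -[RHS](@Rintegral_translation _ a (fun s => complex.Im (h s))).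
  by apply: eq_Rintegral => s _; rewrite -E.
exact: continuous_measurable_fun.
Qed.

Lemma radon_combo m (k : 'I_m -> int * int) (d : 'I_m -> R[i]) t :
  radon p (combo phi k d) t = \sum_j d j * radon p phi (t - dotZ p (k j)).
Proof.
pose F j s := phi (rotate p (t, s) - zvec R (k j)).
have Fi j : cintegrable (@lebesgue_measure R) (F j) := (radon_translate _ _).1.
transitivity (\sum_j d j * cintegral (@lebesgue_measure R) (F j)); last first.
  by apply: eq_bigr => j _; congr (_ * _); exact: (radon_translate _ _).2.
under eq_bigr => j _ do rewrite -(cintegralZ _ (Fi j)).
by rewrite -cintegral_sum// => j; exact: cintegrableZ.
Qed.

End directions.

Lemma box_radius_ge0 (R : realType) (N1 M1 N2 M2 : R) : 0 <= box_radius N1 M1 N2 M2.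
Proof. by rewrite /box_radius !le_max normr_ge0. Qed.

Lemma sup_norm_on_ge0 (R : realType) (A : set (R * R)) (g : R * R -> R[i]) :
  0 <= sup_norm_on A g.
Proof.
rewrite /sup_norm_on; set X := (X in sup X).
have [hX|nX] := pselect (has_sup X); last by rewrite sup_out.
have [[_ [x Ax _]] _] := hX; apply: (@le_trans _ _ (cmod (g x))); first exact: sqrtr_ge0.
by apply: (sup_upper_bound hX); exists x.
Qed.

Lemma dv_dir (R : realType) (A : set (R * R)) (p : R * R) : dv A p -> dot p p = 1.
Proof. by move=> [t [x [-> _ _ _]]]; rewrite /dot/= -!expr2 cos2Dsin2. Qed.

(** The direction comes from a nonzero point [x] of a zero-free disc, and [x] is itself [enorm x]
    times [p]. As [delta_max] is a supremum, some admissible radius already exceeds the distance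
    from the centre to [x]. *)
Lemma DV_nonzero (R : realType) (g : R * R -> R[i]) (p : R * R) :
  DV g p -> dot p p = 1 /\ exists a : R, g (a * p.1, a * p.2) != 0.
Proof.
move=> [y gy dvp]; split; first exact: dv_dir dvp.
have [theta [x [-> _ xd xE]]] := dvp; exists (enorm x); rewrite /= -xE.
by have /ereal_sup_gt[d [_ gd] xe] := xd; exact: gd.
Qed.

(** If two distinct indices had the same projection, [p] would be orthogonal to their difference; it
    would then lie in the null set and, being a unit vector, be its own direction. *)
Lemma dotZ_inj (R : realType) (A : set (R * R)) (E : set (int * int)) (p : R * R)
    (a b : int * int) :
  dv A p -> ~ dv (orth_set (Eplus R E)) p -> E a -> E b ->
  dotZ p a = dotZ p b -> a = b.
Proof.
move=> dvp ndv Ea Eb dab; apply/eqP/negPn/negP => ab; apply: ndv.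
have p1 := dv_dir dvp; have [t [_ [pE _ _ _]]] := dvp.
have ep : enorm p = 1 by rewrite /enorm p1 sqrtr1.
have p0 : p != 0.
  apply/eqP => p0; move: p1; rewrite p0 /dot/= !mul0r addr0.
  by move/esym/eqP; rewrite oner_eq0.
exists t, p; split => //; last by rewrite ep !mul1r.
split=> //; exists (zvec R a - zvec R b); split.
- apply: contra ab => /eqP; rewrite /zvec => -[] /eqP + /eqP.
  by rewrite !subr_eq0 !eqr_int; case: a b {Ea Eb dab} => a1 a2 [b1 b2] /= /eqP -> /eqP ->.
- by exists a, b; split.
- by move: dab; rewrite /dotZ /dot /zvec/=; lra.
Qed.

Theorem proposition4p6 (R : realType) (phi : R * R -> R[i])
    (N1 M1 N2 M2 : R)
    (phi_C1 : C1 phi)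
    (phi_compact : compact (supp phi))
    (phi_supp : supp phi `<=` box N1 M1 N2 M2)
    (phi_hat0 : fourier phi 0 = 0)
    (phi_nu2 : ((1 / 2 : R)%:E < nu2 phi)%E)
    (phi_indep : shifts_lin_indep phi)
    (f : R * R -> R[i]) (a1 b1 a2 b2 : R)
    (f_space : shift_space phi f)
    (f_supp : supp f `<=` box a1 b1 a2 b2)
    (E : set (int * int))
    (E_def : E = index_set N1 M1 N2 M2 a1 b1 a2 b2)
    (E_neq0 : E !=set0)
    (m : nat) (k : 'I_m -> int * int)
    (k_inj : injective k) (k_enum : range k = E)
    (f_target : exists c : 'I_m -> R[i], f = combo phi k c)
    (p : R * R)
    (p_dir : (DV (fourier phi) `\` dv (orth_set (Eplus R E))) p) :
  exists x : 'I_m -> R,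
    [/\ range x `<=` Y_p phi N1 M1 N2 M2 E p k,
        \matrix_(j < m, n < m) radon p phi (x j - dotZ p (k n)) \in unitmx &
        determined_at phi k p f (range x)].
Proof.
have [DVp ndv] := p_dir.
have [p1 [a fa]] := DV_nonzero DVp.
have [? _ dvp] := DVp.
have m0 : (0 < m)%N.
  by case: E_neq0 => e; rewrite -k_enum => -[j _ _]; exact: leq_ltn_trans (ltn_ord j).
pose S := sup_norm_on (box N1 M1 N2 M2) (cderive phi (e1 R)) +
          sup_norm_on (box N1 M1 N2 M2) (cderive phi (e2 R)).
pose B := box_radius N1 M1 N2 M2.
have S_ge0 : 0 <= S by rewrite addr_ge0// sup_norm_on_ge0.
have B_ge0 : 0 <= B := box_radius_ge0 _ _ _ _.
have Re_lip := Re_lipschitz phi_C1 phi_compact phi_supp.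
have Im_lip := Im_lipschitz phi_C1 phi_compact phi_supp.
rewrite -/S in Re_lip Im_lip.
have phi_B : forall x, phi x != 0 -> `|x.1| <= B /\ `|x.2| <= B := box_radius_support phi_supp.
pose c := Num.sqrt 2 * B; pose Lam := 2 * c * S.
pose tau j := dotZ p (k j).
have tau_inj : injective tau.
  move=> i j tij; apply: k_inj.
  by apply: (dotZ_inj dvp ndv) => //; rewrite -k_enum; [exists i|exists j].
have r_c := radon_support p1 phi_B B_ge0.
have r_test := radon_test p1 Re_lip Im_lip phi_B B_ge0 S_ge0.
have r_Re := radon_Re_lipschitz p1 Re_lip phi_B B_ge0 S_ge0.
have r_Im := radon_Im_lipschitz p1 Im_lip phi_B B_ge0 S_ge0.
have [t0 rt0] : exists t, radon p phi t != 0.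
  apply: contrapT => /forallNP r0; move/negP: fa; apply; apply/eqP.
  apply: (fourier_slice_eq0 p1 Re_lip Im_lip phi_B) => // t; apply/eqP/negPn/negP/r0.
have c_ge0 : 0 <= c by rewrite mulr_ge0// sqrtr_ge0.
have Lam_ge0 : 0 <= Lam by rewrite !mulr_ge0.
(* With a zero Lipschitz constant the Radon transform would be constant, hence 0, its value at
   [c + 1] outside the support. This keeps the denominator of [delta_p] away from 0. *)
have Lam_neq0 : Lam != 0.
  apply: contraNneq rt0 => L0.
  have r1 : radon p phi (c + 1) = 0.
    by apply/eqP/negPn/negP => /r_c; rewrite ger0_norm ?addr_ge0// gerDl ler10.
  have := r_Re t0 (c + 1); have := r_Im t0 (c + 1).
  rewrite -/c -/Lam L0 r1 /= !mul0r !subr0 !normr_le0 eq_complex /= => /eqP -> /eqP ->.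
  by rewrite !eqxx.
have [S_gt0 B_gt0] : 0 < S /\ 0 < B.
  move: Lam_neq0; rewrite /Lam /c !mulf_eq0 !negb_or => /andP[/andP[_ /andP[_ Bn0]] Sn0].
  by rewrite !lt_def S_ge0 B_ge0 Sn0 Bn0.
have c_gt0 : 0 < c by rewrite mulr_gt0// sqrtr_gt0.
pose L := L1 N1 M1 N2 M2 E p; pose U := L2 N1 M1 N2 M2 E p.
(* A crude bound, enough to make the [inf] and [sup] over [E] genuine bounds on the projections. *)
have tau_b j : `|tau j| <= \sum_i `|tau i|.
  by rewrite (bigD1 j)//= lerDl sumr_ge0.
have inf_tau j : inf [set dotZ p k | k in E] <= tau j.
  apply: ge_inf; last by exists (k j) => //; rewrite -k_enum; exists j.
  exists (- \sum_i `|tau i|) => _ [z + <-]; rewrite -k_enum => -[i _ <-].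
  by have := tau_b i; rewrite ler_norml => /andP[].
have sup_tau j : tau j <= sup [set dotZ p k | k in E].
  apply: ub_le_sup; last by exists (k j) => //; rewrite -k_enum; exists j.
  exists (\sum_i `|tau i|) => _ [z + <-]; rewrite -k_enum => -[i _ <-].
  by have := tau_b i; rewrite ler_norml => /andP[].
have tau_LU j : L <= tau j - c /\ tau j + c <= U.
  have := inf_tau j; have := sup_tau j; rewrite /L /U /L1 /L2 -/B mulNr -/c.
  by move=> ? ?; split; lra.
have LU : L < U by have [] := tau_LU (Ordinal m0); lra.
have gramE : gram phi p k = translates_gram (radon p phi) tau by [].
pose lam := lambda_min (gram phi p k).
have lam0 : 0 < lam.
  rewrite /lam gramE; apply: lambda_min_gt0 => //; first exact: translates_gram_herm.
  exact: (translates_gram_pos r_test r_c rt0 tau_inj).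
pose delta := delta_p phi N1 M1 N2 M2 E p k.
have mR0 : (0 : R) < m%:R by rewrite ltr0n.
have q0 : 0 < lam / (3 * m%:R * (U - L)) by rewrite divr_gt0// !mulr_gt0// subr_gt0.
have delta0 : 0 < delta.
  by rewrite /delta /delta_p -/S -/B -/lam -/L -/U divr_gt0 ?sqrtr_gt0// !mulr_gt0.
(* Here $\Lambda^2=8B^2S^2$, while the denominator of [delta_p] squares to $4S^2B^2$; the remaining
   2 is the one in [/ 2]. *)
have delta2 : (U - L) * (Lam ^+ 2 * delta ^+ 2 / 2 * m%:R) = lam / 3.
  rewrite /delta /delta_p -/S -/B -/lam -/L -/U expr_div_n sqr_sqrtr ?ltW//.
  rewrite /Lam /c !exprMn sqr_sqrtr//.
  by field; rewrite !gt_eqF ?subr_gt0.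
have delta_small : (U - L) * (Lam ^+ 2 * delta ^+ 2 / 2 * m%:R)
    < lambda_min (translates_gram (radon p phi) tau).
  by rewrite delta2 -gramE -/lam; lra.
pose K := Num.ceil ((U - L) / delta).
have K_gt0 : 0 < K by rewrite ceil_gt0 divr_gt0// subr_gt0.
pose y (l : nat) : R := L + (U - L) / K%:~R * l%:~R.
(* One row for each of the $K+1$ grid points, numbered here from 0. A vector in the kernel is a
   combination of translates that vanishes on the whole grid. *)
pose W : 'M[R[i]]_(`|K|%N.+1, m) := \matrix_(l, n) radon p phi (y l - tau n).
have W_full : row_full W.
  rewrite /row_full -mxrank_tr; apply: (inj_row_free (A := W^T)) => v vW.
  apply: (comb_sampling r_test r_c rt0 tau_inj r_Re r_Im Lam_ge0 LU tau_LU delta0 delta_small).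
  move=> x xLU; have [l /andP[l1 lK] xl] := grid_near LU delta0 xLU.
  have lE : `|l - 1|%N = l - 1 :> int by rewrite gez0_abs// subr_ge0.
  have l0 : (`|l - 1|%N < `|K|.+1)%N by rewrite ltnS -lez_nat lE gtz0_abs// lerBlDr.
  exists (y `|l - 1|%N); split; last by rewrite /y lE.
  have /matrixP/(_ 0 (Ordinal l0)) := vW.
  by rewrite !mxE => <-; apply: eq_bigr => j _; rewrite !mxE.
pose g := fullrankfun W_full.
exists (fun j => y (g j)); split.
- move=> _ [j _ <-]; exists ((g j : nat)%:Z + 1) => /=; last by rewrite addrK.
  rewrite lerDr lerD2r /=; have := ltn_ord (g j).
  by rewrite ltnS -lez_nat => /le_trans; apply; rewrite gtz0_abs.
- rewrite (_ : \matrix_(_, _) _ = rowsub g W); first exact: fullrowsub_unit.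
  by apply/matrixP => j n; rewrite !mxE.
- move=> h [d hE] hf; have [e fE] := f_target; rewrite hE fE.
  have W_unit : rowsub g W \in unitmx by exact: fullrowsub_unit.
  (* By linearity the invertible sampling matrix sends the difference of the two coefficient vectors
     to the difference of the samples, which is 0. *)
  suff : \col_j (d j - e j) = 0.
    move/matrixP => de; congr combo; apply/funext => j.
    by have := de j 0; rewrite !mxE => /eqP; rewrite subr_eq0 => /eqP.
  rewrite -[LHS](mulKmx W_unit) (_ : rowsub g W *m _ = 0) ?mulmx0//.
  apply/matrixP => j i; rewrite !mxE.
  have := hf (y (g j)) (ex_intro2 _ _ j I erefl).
  rewrite hE fE !(radon_combo p1 Re_lip Im_lip phi_B B_ge0 S_ge0) => /eqP.
  rewrite -subr_eq0 -sumrB => /eqP E0; rewrite -[RHS]E0; apply: eq_bigr => n _.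
  by rewrite !mxE mulrBr ![radon _ _ _ * _]mulrC.
Qed.
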